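(* Under Assumptions 1-MP, 2-MP (a),(b),(c), 3-MP and Strong Parallel Trends (5-MP), for all $g,k\in\mathcal{G}\setminus\{\mathcal{T}+1\}$ with $k>g$: $$\delta^{WITHIN}(g)=\int_{\mathcal{D}_+}w_1^{within}(g,l)\,\overline{ACR}^{POST(g)}(g,l)\,dl,$$ $$\delta^{MID,PRE}(g,k)=\int_{\mathcal{D}_+}w_1(g,l)\,\overline{ACR}^{MID(g,k)}(g,l)\,dl+w_0(g)\frac{\overline{ATE}^{MID(g,k)}(g,d_L)}{d_L},$$ $$\delta^{POST,MID}(g,k)=\int_{\mathcal{D}_+}w_1(k,l)\,\overline{ACR}^{POST(k)}(k,l)\,dl+w_0(k)\frac{\overline{ATE}^{POST(k)}(k,d_L)}{d_L}-w_0(k)\frac{\pi^{POST(k),PRE(g)}(g)-\pi^{MID(g,k),PRE(g)}(g)}{d_L},$$ and, when $\mathbb{E}[D\mid G=g]\ne\mathbb{E}[D\mid G=k]$, $$\delta^{POST,PRE}(g,k)=\int_{\mathcal{D}_+}w_1^{across}(g,k,l)\,\overline{ACR}^{POST(k)}(g,l)\,dl-\Big\{\int_{\mathcal{D}_+}\tilde w_1^{across}(g,k,l)\Big(\frac{\partial\pi_D^{POST(k),PRE(g)}(k,l)}{\partial l}-\frac{\partial\pi_D^{POST(k),PRE(g)}(g,l)}{\partial l}\Big)dl+\tilde w_0^{across}(g,k)\frac{\pi_D^{POST(k),PRE(g)}(k,d_L)-\pi_D^{POST(k),PRE(g)}(g,d_L)}{d_L}\Big\},$$ with the weights having the nonnegativity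 and normalization properties $w_1^{within},w_1,w_0\ge0$, $\int w_1^{within}(g,l)dl=1$, $\int w_1(g,l)dl+w_0(g)=1$, $\int w_1^{across}(g,k,l)dl=1$.
   Context: Multi-period setup. Periods $t=1,\dots,\mathcal{T}$. Each unit has a timing group $G\in\mathcal{G}\subseteq\{2,\dots,\mathcal{T}+1\}$ ($G=\mathcal{T}+1$ means never treated) and a dose $D\ge0$, with $D=0$ exactly for never-treated units and $D\in\mathcal{D}_+$ for units with $G\le\mathcal{T}$. Potential outcomes $Y_t(g,d)$; $Y_t(0):=Y_t(\mathcal{T}+1,0)$. $W_t:=D\mathbf{1}\{t\ge G\}$. Observed $Y_t=Y_t(0)\mathbf{1}\{t<G\}+Y_t(G,D)\mathbf{1}\{t\ge G\}$; finite second moments. 1-MP: i.i.d. sampling of $(Y_1,\dots,Y_{\mathcal{T}},D,G)$. 2-MP: (a) support of $D$ is $\{0\}\cup\mathcal{D}_+$, $\mathbb{P}(D=0)>0$, every $d\in\mathcal{D}_+$ in the support of $D\mid G=g$ for $g\le\mathcal{T}$; (b) $\mathcal{D}_+=[d_L,d_U]$, $0<d_L<d_U<\infty$; (c) $d\mapsto\mathbb{E}[\Delta Y_t\mid G=g,D=d]$ continuously differentiable on $\mathcal{D}_+$. 3-MP: (a) $Y_t(g,d)=Y_t(0)$ for $t<g$; (b) $W_1=0$, $W_{t-1}=d\Rightarrow W_t=d$. 5-MP: for all $g\in\mathcal{G}$, $t=2,\dots,\mathcal{T}$, $d\in\mathcal{D}$: $\mathbb{E}[Y_t(g,d)-Y_{t-1}(0)\mid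 G=g,D=d]=\mathbb{E}[Y_t(g,d)-Y_{t-1}(0)\mid G=g]$ and $\mathbb{E}[\Delta Y_t(0)\mid G=g,D=d]=\mathbb{E}[\Delta Y_t(0)\mid D=0]$, where $\Delta Y_t(0)=Y_t(0)-Y_{t-1}(0)$. Parameters: $ATE(g,t,d):=\mathbb{E}[Y_t(g,d)-Y_t(0)\mid G=g]$; for a window $A=(t_1,t_2)$, $\overline{ATE}^{A}(g,d):=\frac1{t_2-t_1+1}\sum_{t=t_1}^{t_2}ATE(g,t,d)$ and $\overline{ACR}^A(g,d):=\partial\overline{ATE}^A(g,d)/\partial d$. Notation: $\bar Y^{(t_1,t_2)}:=\frac1{t_2-t_1+1}\sum_{t=t_1}^{t_2}Y_t$; for $g<k$: $PRE(g)=(1,g-1)$, $MID(g,k)=(g,k-1)$, $POST(k)=(k,\mathcal{T})$, $\bar Y^A$ the average over window $A$. $\pi_D^{A,B}(g,d):=\mathbb{E}[\bar Y^A-\bar Y^B\mid G=g,D=d]-\mathbb{E}[\bar Y^A-\bar Y^B\mid D=0]$; $\pi^{A,B}(g):=\mathbb{E}[\bar Y^A-\bar Y^B\mid G=g]-\mathbb{E}[\bar Y^A-\bar Y^B\mid D=0]$. Comparisons: $\delta^{WITHIN}(g):=\mathrm{cov}(\bar Y^{POST(g)}-\bar Y^{PRE(g)},D\mid G=g)/\mathrm{var}(D\mid G=g)$; $\delta^{MID,PRE}(g,k):=(\mathbb{E}[\bar Y^{MID(g,k)}-\bar Y^{PRE(g)}\mid G=g]-\mathbb{E}[\bar Y^{MID(g,k)}-\bar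 Y^{PRE(g)}\mid G=k])/\mathbb{E}[D\mid G=g]$; $\delta^{POST,MID}(g,k):=(\mathbb{E}[\bar Y^{POST(k)}-\bar Y^{MID(g,k)}\mid G=k]-\mathbb{E}[\bar Y^{POST(k)}-\bar Y^{MID(g,k)}\mid G=g])/\mathbb{E}[D\mid G=k]$; $\delta^{POST,PRE}(g,k):=(\mathbb{E}[\bar Y^{POST(k)}-\bar Y^{PRE(g)}\mid G=g]-\mathbb{E}[\bar Y^{POST(k)}-\bar Y^{PRE(g)}\mid G=k])/(\mathbb{E}[D\mid G=g]-\mathbb{E}[D\mid G=k])$. Weights: $w_1^{within}(g,l):=\frac{(\mathbb{E}[D\mid G=g,D\ge l]-\mathbb{E}[D\mid G=g])\mathbb{P}(D\ge l\mid G=g)}{\mathrm{var}(D\mid G=g)}$; $w_1(g,l):=\frac{\mathbb{P}(D\ge l\mid G=g)}{\mathbb{E}[D\mid G=g]}$; $w_0(g):=\frac{d_L}{\mathbb{E}[D\mid G=g]}$; $w_1^{across}(g,k,l):=\frac{\mathbb{P}(D\ge l\mid G=g)-\mathbb{P}(D\ge l\mid G=k)}{\mathbb{E}[D\mid G=g]-\mathbb{E}[D\mid G=k]}$; $\tilde w_1^{across}(g,k,l):=\frac{\mathbb{P}(D\ge l\mid G=k)}{\mathbb{E}[D\mid G=g]-\mathbb{E}[D\mid G=k]}$; $\tilde w_0^{across}(g,k):=\frac{d_L}{\mathbb{E}[D\mid G=g]-\mathbb{E}[D\mid G=k]}$. *)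

(* Defs.v *)
From HB Require Import structures.
From mathcomp Require Import all_boot all_order all_algebra.
From mathcomp Require Import all_classical all_reals all_analysis.
Set Implicit Arguments. Unset Strict Implicit. Unset Printing Implicit Defensive.
Import Order.TTheory GRing.Theory Num.Theory.
Import numFieldNormedType.Exports.
Local Open Scope classical_set_scope.
Local Open Scope ring_scope.

(* The population model of one draw (Y_1..Y_T, D, G) together with the
   potential outcomes Y_t(g,d). *)
Record model (T : Type) (R : realType) := Model {
  nT : nat;                          (* number of periods \mathcal T *)
  Dv : T -> R;
  Gv : T -> nat;                     (* timing group G ; nT.+1 = never treated *)
  Yp : nat -> nat -> R -> T -> R;    (* Yp t g d = Y_t(g,d) *)
  dL : R;                            (* D_+ = [dL, dU] *)
  dU : R }.

Section Defs.
Context {dsp : measure_display} {T : measurableType dsp} {R : realType}.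
Variables (P : probability T R) (M : model T R).

Definition Pr (A : set T) : R := fine (P A).
Definition Eon (X : T -> R) (A : set T) : R := fine (\int[P]_(w in A) (X w)%:E).
Definition condE (X : T -> R) (A : set T) : R := Eon X A / Pr A.
Definition condP (A B : set T) : R := Pr (A `&` B) / Pr B.

Definition evG (g : nat) : set T := [set w | Gv M w = g].
Definition evDge (l : R) : set T := [set w | l <= Dv M w].
Definition evD0 : set T := [set w | Dv M w = 0].

Definition E_G (X : T -> R) (g : nat) : R := condE X (evG g).
Definition E_D0 (X : T -> R) : R := condE X evD0.

Definition inG (g : nat) : Prop := 0 < Pr (evG g).
Definition inDose (x : R) : Prop := x = 0 \/ dL M <= x <= dU M.

Definition ev_GDnear (g : nat) (x e : R) : set T :=
  [set w | Gv M w = g /\ `|Dv M w - x| <= e].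
Definition has_condE_GD (X : T -> R) (g : nat) (x v : R) : Prop :=
  (fun e => condE X (ev_GDnear g x e)) @ 0^'+ --> v.
Definition condE_GD (X : T -> R) (g : nat) (x : R) : R :=
  lim ((fun e => condE X (ev_GDnear g x e)) @ 0^'+).
Definition in_supp_GD (g : nat) (x : R) : Prop :=
  forall e : R, 0 < e -> 0 < Pr (ev_GDnear g x e).
Definition in_supp_D (x : R) : Prop :=
  forall e : R, 0 < e -> 0 < Pr [set w | `|Dv M w - x| <= e].

Definition Y0 (t : nat) : T -> R := Yp M t (nT M).+1 0.
Definition Yobs (t : nat) (w : T) : R :=
  if (t < Gv M w)%N then Y0 t w else Yp M t (Gv M w) (Dv M w) w.
Definition dYobs (t : nat) (w : T) : R := Yobs t w - Yobs t.-1 w.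
Definition W (t : nat) (w : T) : R := if (Gv M w <= t)%N then Dv M w else 0.

Definition wlen (A : nat * nat) : R := (A.2 - A.1 + 1)%:R.
Definition Ybar (A : nat * nat) (w : T) : R :=
  (\sum_(A.1 <= t < A.2.+1) Yobs t w) / wlen A.
Definition PRE (g : nat) : nat * nat := (1%N, g.-1).
Definition MID (g k : nat) : nat * nat := (g, k.-1).
Definition POST (k : nat) : nat * nat := (k, nT M).
Definition dYbar (A B : nat * nat) (w : T) : R := Ybar A w - Ybar B w.

Definition dq (f : R -> R) (x : R) : R -> R := fun y => (f y - f x) / (y - x).
Definition inDp (y : R) : Prop := dL M <= y <= dU M.
(* derivative of f at x relative to [dL, dU] (one-sided at the endpoints) *)
Definition deriv_Dp (f : R -> R) (x : R) : R :=
  lim (dq f x @ within inDp x^').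
Definition C1_Dp (f : R -> R) : Prop :=
  exists f' : R -> R, {within `[dL M, dU M], continuous f'} /\
    forall x, inDp x -> dq f x @ within inDp x^' --> f' x.

Definition ATE (g t : nat) (x : R) : R := E_G (fun w => Yp M t g x w - Y0 t w) g.
Definition ATEbar (A : nat * nat) (g : nat) (x : R) : R :=
  (\sum_(A.1 <= t < A.2.+1) ATE g t x) / wlen A.
Definition ACRbar (A : nat * nat) (g : nat) (x : R) : R :=
  deriv_Dp (ATEbar A g) x.

Definition piD (A B : nat * nat) (g : nat) (x : R) : R :=
  condE_GD (dYbar A B) g x - E_D0 (dYbar A B).
Definition piG (A B : nat * nat) (g : nat) : R :=
  E_G (dYbar A B) g - E_D0 (dYbar A B).

Definition meanD (g : nat) : R := E_G (Dv M) g.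
Definition varD (g : nat) : R := E_G (fun w => (Dv M w - meanD g) ^+ 2) g.
Definition covD (X : T -> R) (g : nat) : R :=
  E_G (fun w => (X w - E_G X g) * (Dv M w - meanD g)) g.

Definition delta_within (g : nat) : R :=
  covD (dYbar (POST g) (PRE g)) g / varD g.
Definition delta_mid_pre (g k : nat) : R :=
  (E_G (dYbar (MID g k) (PRE g)) g - E_G (dYbar (MID g k) (PRE g)) k) / meanD g.
Definition delta_post_mid (g k : nat) : R :=
  (E_G (dYbar (POST k) (MID g k)) k - E_G (dYbar (POST k) (MID g k)) g) / meanD k.
Definition delta_post_pre (g k : nat) : R :=
  (E_G (dYbar (POST k) (PRE g)) g - E_G (dYbar (POST k) (PRE g)) k)
    / (meanD g - meanD k).

Definition w1_within (g : nat) (l : R) : R :=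
  (condE (Dv M) (evG g `&` evDge l) - meanD g) * condP (evDge l) (evG g) / varD g.
Definition w1 (g : nat) (l : R) : R := condP (evDge l) (evG g) / meanD g.
Definition w0 (g : nat) : R := dL M / meanD g.
Definition w1_across (g k : nat) (l : R) : R :=
  (condP (evDge l) (evG g) - condP (evDge l) (evG k)) / (meanD g - meanD k).
Definition tw1_across (g k : nat) (l : R) : R :=
  condP (evDge l) (evG k) / (meanD g - meanD k).
Definition tw0_across (g k : nat) : R := dL M / (meanD g - meanD k).

End Defs.

(* Main.v *)
Require Import Defs.
From HB Require Import structures.
From mathcomp Require Import all_boot all_order all_algebra.
From mathcomp Require Import all_classical all_reals all_analysis.
From mathcomp Require Import measurable_realfun ring lra.
Import Order.TTheory GRing.Theory Num.Theory.
Import numFieldNormedType.Exports.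
Local Open Scope classical_set_scope.
Local Open Scope ring_scope.

(* Conditioning on D = x is a limit over shrinking symmetric balls, so the key
   step is to recover E[X; G = g, D in A] from these limits.  Let mu be the law
   of D on {G = g} and f the Radon-Nikodym derivative of A |-> E[X; G = g, D in A].
   On the line, averaging over centred balls is bounded on L1(mu) with constant 2,
   hence the averages of f converge to f in L1(mu), and by Fatou their pointwise
   limit can only be f.  Strong parallel trends then identify the conditional
   mean of an outcome change given D = x with ATEbar(g, x) plus a constant;
   writing m(D) = m(dL) + \int_dL^D m'(l) dl and exchanging the integrals gives
   every decomposition. *)

Set Implicit Arguments.
Unset Strict Implicit.
Unset Printing Implicit Defensive.


(** * Averages over centred intervals *)

(** The law of D on {G = g} is an arbitrary finite measure carried by [dL, dU], without density or
    doubling property, so integrals have to be differentiated with respect to that measure itself.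
    No maximal inequality is proved: the assumptions already assert that the ball limits exist at
    every dose, and only their value has to be identified, which convergence in L1 can do.
    E[X; G = g, D in A] is needed for half-lines A and not only for the whole line, because the
    covariance in [delta_within] pairs X with D. Smoothness is assumed for observed one-period
    changes and parallel trends are stated period by period; both reach the window averages by
    summation from period 1, at which no group is treated yet. The derivative does not see m(dL),
    the jump from no treatment to the smallest dose: this is the origin of the terms evaluated at
    dL. *)

Section ball_average.
Context {R : realType}.
Variable mu : {finite_measure set R -> \bar R}.
Implicit Types (e x y : R) (f g : R -> R).

Definition cball x e : set R := [set y | `|y - x| <= e].

Lemma cballE x e : cball x e = `[x - e, x + e]%classic.
Proof.
by apply/seteqP; split => y; rewrite /cball /= in_itv /= ler_distl.
Qed.

Lemma measurable_cball x e : measurable (cball x e).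
Proof. by rewrite cballE. Qed.

(** Its sections are the balls [cball x e], so measurability of x |-> mu(ball) is an instance of
    measurability of section measures. *)
Definition strip e : set (R * R) := [set z | `|z.2 - z.1| <= e].

Lemma measurable_strip e : measurable (strip e).
Proof.
have m : measurable_fun setT (fun z : R * R => `|z.2 - z.1|).
  apply: measurableT_comp => //.
  exact: measurable_funB measurable_snd measurable_fst.
rewrite -[strip e]setTI.
rewrite (_ : strip e = (fun z : R * R => `|z.2 - z.1|) @^-1` `]-oo, e]).
  exact: m.
by apply/seteqP; split => z /=; rewrite in_itv.
Qed.

Lemma xsection_strip e x : xsection (strip e) x = cball x e.
Proof. by apply/seteqP; split => y; rewrite /xsection /= inE. Qed.

Lemma fine_mu A : measurable A -> (fine (mu A))%:E = mu A.
Proof. by move=> mA; rewrite fineK// fin_num_measure. Qed.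

(** Averaging over balls as an integral kernel, jointly measurable so that Tonelli applies. Around a
    centre whose ball is null the inverse is 0 by convention and the kernel vanishes. *)
Definition avg_kernel e (z : R * R) : R :=
  (fine (mu (cball z.1 e)))^-1 * \1_(strip e) z.

Lemma avg_kernel_ge0 e z : 0 <= avg_kernel e z.
Proof. by rewrite mulr_ge0// invr_ge0 fine_ge0. Qed.

Lemma measurable_inv_ge0 d (T : measurableType d) (f : T -> R) :
  (forall t, 0 <= f t) -> measurable_fun setT f ->
  measurable_fun setT (fun t => (f t)^-1).
Proof.
(* On nonnegative reals the inverse is the power -1, which is measurable with no exception at 0. *)
move=> f0 mf; under eq_fun do rewrite -powR_inv1//.
exact: (measurableT_comp (measurable_powR (-1)) mf).
Qed.

Lemma measurable_mu_cball e :
  measurable_fun setT (fun x => fine (mu (cball x e))).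
Proof.
apply: measurableT_comp => //.
under eq_fun do rewrite -xsection_strip.
exact: measurable_fun_xsection (measurable_strip e).
Qed.

Lemma measurable_avg_kernel e : measurable_fun setT (avg_kernel e).
Proof.
apply: measurable_funM; last by apply: measurable_indic; exact: measurable_strip.
apply: measurable_inv_ge0 => [x|]; first exact: fine_ge0.
exact: (measurableT_comp (measurable_mu_cball e) measurable_fst).
Qed.

(** Every ball centred in [A] contains [A], so the integrand is at most 1 / mu(A) on [A]. If [A] is
    null the integral is 0. *)
Lemma int_inv_mu_cball_le1 e (A : set R) : measurable A ->
  (forall x, A x -> A `<=` cball x e) ->
  (\int[mu]_(x in A) ((fine (mu (cball x e)))^-1)%:E <= 1)%E.
Proof.
move=> mA sub.
have mi : measurable_fun A (fun x => ((fine (mu (cball x e)))^-1)%:E).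
  by apply/measurable_EFinP/measurable_funTS/measurable_inv_ge0 => [?|];
    [exact: fine_ge0|exact: measurable_mu_cball].
have [A0|A0] := eqVneq (mu A) 0%E.
  rewrite (_ : integral _ _ _ = 0%E) ?lee01//.
  under eq_integral do rewrite -[((fine _)^-1)%:E]gee0_abs ?lee_fin ?invr_ge0 ?fine_ge0//.
  exact: integral_abs_eq0.
have c0 : 0 < fine (mu A).
  by rewrite fine_gt0// lt0e A0 measure_ge0 ltey_eq fin_num_measure.
apply: (@le_trans _ _ (\int[mu]_(x in A) (cst ((fine (mu A))^-1)%:E x))%E).
  apply: ge0_le_integral => //.
  - by move=> x _; rewrite lee_fin invr_ge0 fine_ge0.
  move=> x Ax; rewrite lee_fin lef_pV2 ?posrE//.
    apply: fine_le; rewrite ?fin_num_measure//; first exact: measurable_cball.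
    by apply: le_measure; rewrite ?inE//; [exact: measurable_cball|exact: sub].
  apply: (lt_le_trans c0).
  apply: fine_le; rewrite ?fin_num_measure//; first exact: measurable_cball.
  by apply: le_measure; rewrite ?inE//; [exact: measurable_cball|exact: sub].
by rewrite integral_cst// -[X in (_ * X)%E]fine_mu// -EFinM mulVf ?gt_eqF.
Qed.

(** The mass is 1, or 0 when the ball is null; the inequality covers both. *)
Lemma avg_kernel_int2 e x : (\int[mu]_y (avg_kernel e (x, y))%:E <= 1)%E.
Proof.
rewrite /avg_kernel /=.
have mB := measurable_cball x e.
have -> : (fun y => ((fine (mu (cball x e)))^-1 * \1_(strip e) (x, y))%:E) =
          (fun y => ((fine (mu (cball x e)))^-1)%:E * (\1_(cball x e) y)%:E)%E.
  by apply/funext => y; rewrite -EFinM -xsection_strip !indicE mem_xsection.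
rewrite ge0_integralZl_EFin//; last 2 first.
- exact/measurable_EFinP/measurable_indic.
- by rewrite invr_ge0 fine_ge0.
rewrite integral_indic// setIT -[X in (_ * X)%E]fine_mu// -EFinM lee_fin.
by have [->|?] := eqVneq (fine (mu (cball x e))) 0; rewrite ?mulr0 ?ler01// mulVf.
Qed.

(* The overlap constant of centred intervals on the line is 2: both halves of
   [y - e, y + e] are contained in every ball of radius e centred in them. *)
Lemma avg_kernel_int1 e y : (\int[mu]_x (avg_kernel e (x, y))%:E <= 2%:E)%E.
Proof.
have [e0|e0] := ltP e 0.
  rewrite integral0_eq ?lee_fin// => x _.
  rewrite /avg_kernel indicE memNset ?mulr0//= => /(le_trans (normr_ge0 _)).
  by rewrite leNgt e0.
have mi (A : set R) : measurable_fun A (fun x => ((fine (mu (cball x e)))^-1)%:E).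
  by apply/measurable_EFinP/measurable_funTS/measurable_inv_ge0 => [?|];
    [exact: fine_ge0|exact: measurable_mu_cball].
pose A := `[y - e, y]%classic : set R; pose B := `]y, y + e]%classic : set R.
have -> : (\int[mu]_x (avg_kernel e (x, y))%:E =
    \int[mu]_(x in A `|` B) ((fine (mu (cball x e)))^-1)%:E)%E.
  rewrite [RHS]integral_mkcond; apply: eq_integral => x _.
  rewrite /avg_kernel patchE indicE.
  have -> : ((x, y) \in strip e) = (x \in A `|` B).
    apply/idP/idP; rewrite !inE /strip /A /B /= !in_itv /= ler_distl.
      case: (leP x y) => xy /andP[h1 h2]; [left|right]; apply/andP; split => //; lra.
    by move=> [|] /andP[h1 h2]; apply/andP; split => //; lra.
  by case: ifP => _; rewrite ?mulr1 ?mulr0.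
rewrite ge0_integral_setU//; last 2 first.
- by move=> x _; rewrite lee_fin invr_ge0 fine_ge0.
- by apply/disj_setPS => x []; rewrite /A /B /= !in_itv /= => /andP[? ?] /andP[? ?]; lra.
rewrite (_ : 2%:E = 1 + 1)%E; last by rewrite -EFinD.
have itvb (x t : R) : `|t - x| <= e = (x - e <= t <= x + e) by rewrite ler_distl.
apply: leeD; apply: int_inv_mu_cball_le1.
- exact: measurable_itv.
- move=> x; rewrite /A /cball /= in_itv /= => /andP[? ?] t.
  by rewrite /= in_itv /= itvb => /andP[? ?]; apply/andP; split; lra.
- exact: measurable_itv.
- move=> x; rewrite /B /cball /= in_itv /= => /andP[? ?] t.
  by rewrite /= in_itv /= itvb => /andP[? ?]; apply/andP; split; lra.
- exact: measurable_itv.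
- exact: measurable_itv.
Qed.

(** Mean oscillation of [f] around [x] at scale [e]. It dominates the distance from the ball average
    to [f x], and unlike that distance it is subadditive in [f] under one nonnegative kernel. *)
Definition osc e f x : \bar R :=
  (\int[mu]_y (avg_kernel e (x, y) * `|f y - f x|)%:E)%E.

Lemma measurable_osc_kernel e f : measurable_fun setT f ->
  measurable_fun setT
    (fun z : R * R => (avg_kernel e z * `|f z.2 - f z.1|)%:E).
Proof.
move=> mf; apply/measurable_EFinP/measurable_funM.
  exact: measurable_avg_kernel.
apply: measurableT_comp => //; apply: measurable_funB.
- exact: (measurableT_comp mf measurable_snd).
- exact: (measurableT_comp mf measurable_fst).
Qed.

Lemma osc_kernel_ge0 e f z :
  (0 <= (avg_kernel e z * `|f z.2 - f z.1|)%:E)%E.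
Proof. by rewrite lee_fin mulr_ge0// avg_kernel_ge0. Qed.

Lemma osc_ge0 e f x : (0 <= osc e f x)%E.
Proof. by apply: integral_ge0 => y _; exact: (osc_kernel_ge0 e f (x, y)). Qed.

Lemma measurable_osc e f : measurable_fun setT f ->
  measurable_fun setT (osc e f).
Proof.
move=> mf.
exact: (measurable_fun_fubini_tonelli_F _ (measurable_osc_kernel e mf)
          (osc_kernel_ge0 e f)).
Qed.

Lemma measurable_avg_kernel_x e x :
  measurable_fun setT (fun y => avg_kernel e (x, y)).
Proof. exact: (measurableT_comp (measurable_avg_kernel e) (pair1_measurable x)). Qed.

Lemma osc_lipschitz_le e f (L : R) x : 0 <= e -> 0 <= L ->
  (forall a b, `|f a - f b| <= L * `|a - b|) -> measurable_fun setT f ->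
  (osc e f x <= (L * e)%:E)%E.
Proof.
move=> e0 L0 Lf mf.
apply: (@le_trans _ _ (\int[mu]_y ((L * e)%:E * (avg_kernel e (x, y))%:E))%E).
  apply: ge0_le_integral => //.
  - by move=> y _; exact: (osc_kernel_ge0 e f (x, y)).
  - exact: (measurableT_comp (measurable_osc_kernel e mf) (pair1_measurable x)).
  - apply/measurable_EFinP/measurable_funM => //; exact: measurable_avg_kernel_x.
  move=> y _; rewrite -EFinM lee_fin /avg_kernel /= indicE mulrC.
  have [/set_mem xy|] := boolP ((x, y) \in strip e); last by rewrite !mulr0.
  rewrite mulr1 ler_wpM2r ?invr_ge0 ?fine_ge0//.
  by rewrite (le_trans (Lf _ _))// ler_wpM2l.
rewrite ge0_integralZl_EFin//; last 3 first.
- by move=> y _; rewrite lee_fin avg_kernel_ge0.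
- by apply/measurable_EFinP; exact: measurable_avg_kernel_x.
- by rewrite mulr_ge0.
rewrite -[leRHS]mule1; apply: lee_wpmul2l; first by rewrite lee_fin mulr_ge0.
exact: avg_kernel_int2.
Qed.

End ball_average.


(** * Stability of the mean oscillation in L1(mu) *)

Section ball_average_perturbation.
Context {R : realType}.
Variable mu : {finite_measure set R -> \bar R}.
Implicit Types (e x y : R) (f g : R -> R).

(** With h = |f - g|, |f y - f x| <= |g y - g x| + h y + h x. After Tonelli the term h y costs the
    overlap constant 2, and the term h x costs the kernel mass 1, whence 3. *)
Lemma int_osc_perturb e f g : measurable_fun setT f -> measurable_fun setT g ->
  (\int[mu]_x osc mu e f x <=
   \int[mu]_x osc mu e g x + 3%:E * \int[mu]_x (`|f x - g x|)%:E)%E.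
Proof.
move=> mf mg.
pose h x := `|f x - g x|.
have mh : measurable_fun setT h.
  by apply: measurableT_comp => //; exact: measurable_funB.
have hr0 x : 0 <= h x by exact: normr_ge0.
have h0 x : (0 <= (h x)%:E)%E by rewrite lee_fin.
have mk := measurable_avg_kernel mu e.
have mkx := measurable_avg_kernel_x mu e.
have k0 z := avg_kernel_ge0 mu e z.
have mkh : measurable_fun setT (fun z : R * R => (avg_kernel mu e z * h z.2)%:E).
  apply/measurable_EFinP/measurable_funM => //.
  exact: (measurableT_comp mh measurable_snd).
have kh0 z : (0 <= (avg_kernel mu e z * h z.2)%:E)%E by rewrite lee_fin mulr_ge0.
pose B x := (\int[mu]_y (avg_kernel mu e (x, y) * h y)%:E)%E.
have mB : measurable_fun setT B.
  exact: (measurable_fun_fubini_tonelli_F _ mkh kh0).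
have B0 x : (0 <= B x)%E by apply: integral_ge0 => y _; exact: (kh0 (x, y)).
have intB : (\int[mu]_x B x <= 2%:E * \int[mu]_x (h x)%:E)%E.
  rewrite /B (fubini_tonelli (fun z => (avg_kernel mu e z * h z.2)%:E))//=.
  rewrite -ge0_integralZl_EFin//; last exact/measurable_EFinP.
  apply: ge0_le_integral => //.
  - by move=> y _; apply: integral_ge0 => x _; exact: (kh0 (x, y)).
  - exact: (measurable_fun_fubini_tonelli_G _ mkh kh0).
  - by apply/measurable_EFinP/measurable_funM.
  move=> y _.
  under eq_integral do rewrite mulrC EFinM.
  rewrite ge0_integralZl_EFin//; last 2 first.
  - by move=> x _; rewrite lee_fin.
  - by apply/measurable_EFinP; exact: (measurableT_comp mk (pair2_measurable y)).
  rewrite muleC; apply: lee_wpmul2r => //; exact: avg_kernel_int1.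
have osc_le x : (osc mu e f x <= osc mu e g x + (B x + (h x)%:E))%E.
  apply: (@le_trans _ _ (\int[mu]_y
     ((avg_kernel mu e (x, y) * `|g y - g x|)%:E +
      ((avg_kernel mu e (x, y) * h y)%:E + (h x)%:E * (avg_kernel mu e (x, y))%:E)))%E).
    apply: ge0_le_integral => //.
    - by move=> y _; exact: (osc_kernel_ge0 mu e f (x, y)).
    - exact: (measurableT_comp (measurable_osc_kernel mu e mf) (pair1_measurable x)).
    - apply: emeasurable_funD.
        exact: (measurableT_comp (measurable_osc_kernel mu e mg) (pair1_measurable x)).
      apply: emeasurable_funD.
        exact: (measurableT_comp mkh (pair1_measurable x)).
      by apply/measurable_EFinP/measurable_funM.
    move=> y _; rewrite -!EFinM -!EFinD lee_fin [h x * _]mulrC -!mulrDr ler_wpM2l//.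
    have -> : f y - f x = (g y - g x) + ((f y - g y) + (g x - f x)) by ring.
    rewrite (le_trans (ler_normD _ _))// lerD2l (le_trans (ler_normD _ _))// lerD2l.
    by rewrite /h distrC.
  rewrite ge0_integralD//; last 4 first.
  - by move=> y _; exact: (osc_kernel_ge0 mu e g (x, y)).
  - exact: (measurableT_comp (measurable_osc_kernel mu e mg) (pair1_measurable x)).
  - by move=> y _; rewrite adde_ge0 ?mule_ge0 ?lee_fin//; exact: (kh0 (x, y)).
  - apply: emeasurable_funD; first exact: (measurableT_comp mkh (pair1_measurable x)).
    by apply/measurable_EFinP/measurable_funM.
  rewrite ge0_integralD//; last 3 first.
  - exact: (measurableT_comp mkh (pair1_measurable x)).
  - by move=> y _; rewrite mule_ge0 ?lee_fin.
  - by apply/measurable_EFinP/measurable_funM.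
  apply: leeD => //; apply: leeD => //.
  rewrite ge0_integralZl_EFin//; last 2 first.
  - by move=> y _; rewrite lee_fin.
  - exact/measurable_EFinP.
  rewrite -[leRHS]mule1; apply: lee_wpmul2l => //; exact: avg_kernel_int2.
have mosc := measurable_osc mu e.
apply: (@le_trans _ _ (\int[mu]_x (osc mu e g x + (B x + (h x)%:E)))%E).
  apply: ge0_le_integral => //.
  - by move=> x _; exact: osc_ge0.
  - exact: mosc.
  - apply: emeasurable_funD; first exact: mosc.
    by apply: emeasurable_funD => //; exact/measurable_EFinP.
rewrite ge0_integralD//; last 4 first.
- by move=> x _; exact: osc_ge0.
- exact: mosc.
- by move=> x _; rewrite adde_ge0.
- by apply: emeasurable_funD => //; exact/measurable_EFinP.
apply: leeD => //; rewrite ge0_integralD//; last exact/measurable_EFinP.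
rewrite (_ : 3%:E = 2%:E + 1%:E)%E; last by rewrite -EFinD; congr EFin; ring.
rewrite ge0_muleDl// mul1e; exact: leeD.
Qed.

(** Membership in the L1(mu)-closure of the Lipschitz functions, for which the oscillation at scale
    [e] is at most a multiple of [e]. *)
Definition lipschitz_approx f : Prop :=
  measurable_fun setT f /\
  forall eta : R, 0 < eta -> exists g,
    [/\ measurable_fun setT g,
        exists2 L, 0 <= L & forall a b, `|g a - g b| <= L * `|a - b| &
        (\int[mu]_x (`|f x - g x|)%:E <= eta%:E)%E].

Lemma int_osc_small f : lipschitz_approx f -> forall eta : R, 0 < eta ->
  exists2 e0 : R, 0 < e0 & forall e, 0 <= e -> e <= e0 ->
    (\int[mu]_x osc mu e f x <= eta%:E)%E.
Proof.
move=> [mf af] eta eta0.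
(* The factor 3 of the perturbation bound turns eta / 6 into eta / 2; the Lipschitz part gets the
   other half. *)
have [|g [mg [L L0 Lg] fg]] := af (eta / 6); first by rewrite divr_gt0.
pose m := fine (mu setT).
have m0 : 0 <= m by exact: fine_ge0.
(* The oscillation of [g] integrates to at most L e mu(R) = L m e; adding 1 keeps the divisor
   positive when L or m is 0. *)
pose c := L * m + 1.
have c0 : 0 < c by rewrite ltr_wpDl// mulr_ge0.
exists (eta / 2 / c); first by rewrite !divr_gt0.
move=> e e0 ec.
apply: (le_trans (int_osc_perturb e mf mg)).
rewrite (_ : eta%:E = (eta / 2)%:E + 3%:E * (eta / 6)%:E)%E; last first.
  by rewrite -EFinM -EFinD; congr EFin; field.
apply: leeD; last by apply: lee_wpmul2l => //; rewrite lee_fin.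
apply: (@le_trans _ _ (\int[mu]_x (cst (L * e)%:E x))%E).
  apply: ge0_le_integral => //.
  - by move=> x _; exact: osc_ge0.
  - exact: measurable_osc.
  - by move=> x _; exact: osc_lipschitz_le.
rewrite integral_cst// [X in (_ * X)%E](_ : _ = m%:E); last by rewrite /m fineK// fin_num_measure.
rewrite -EFinM lee_fin.
apply: (@le_trans _ _ (c * e)); first by rewrite mulrAC ler_wpM2r// /c; lra.
by rewrite mulrC -ler_pdivlMr.
Qed.

End ball_average_perturbation.


(** * Density of Lipschitz functions in L1(mu) *)

Lemma ecvg0_le {R : realType} (u : (\bar R)^nat) : u @ \oo --> 0%E ->
  forall eta : R, 0 < eta -> \forall n \near \oo, (u n <= eta%:E)%E.
Proof.
move=> /fine_cvgP[ufin /cvgrPdist_le ul] eta eta0.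
near=> n.
have un : u n \is a fin_num by near: n.
rewrite -(fineK un) lee_fin (le_trans (ler_norm _))//.
have : `|0 - (fine \o u) n| <= eta by near: n; exact: ul.
by rewrite sub0r normrN.
Unshelve. all: by end_near. Qed.

Section lipschitz_density.
Context {R : realType}.
Variable mu : {finite_measure set R -> \bar R}.
Implicit Types (f g h : R -> R).

Lemma L1_triangle f g h : measurable_fun setT f -> measurable_fun setT g ->
  measurable_fun setT h ->
  (\int[mu]_x (`|f x - h x|)%:E <=
   \int[mu]_x (`|f x - g x|)%:E + \int[mu]_x (`|g x - h x|)%:E)%E.
Proof.
move=> mf mg mh.
have mB (u v : R -> R) : measurable_fun setT u -> measurable_fun setT v ->
    measurable_fun setT (fun x => (`|u x - v x|)%:E).
  move=> mu' mv; apply/measurable_EFinP/measurableT_comp => //.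
  exact: measurable_funB.
rewrite -ge0_integralD//; [|exact: mB|exact: mB].
apply: ge0_le_integral => //; first exact: mB.
- by apply: emeasurable_funD; exact: mB.
by move=> x _; rewrite -EFinD lee_fin ler_distD.
Qed.

Lemma lipschitz_approxD f g : lipschitz_approx mu f -> lipschitz_approx mu g ->
  lipschitz_approx mu (f \+ g).
Proof.
move=> [mf af] [mg ag]; split; first exact: measurable_funD.
move=> eta eta0; have eta2 : 0 < eta / 2 by rewrite divr_gt0.
have [f' [mf' [L L0 Lf'] ff']] := af _ eta2.
have [g' [mg' [K K0 Kg'] gg']] := ag _ eta2.
exists (f' \+ g'); split.
- exact: measurable_funD.
- exists (L + K); first exact: addr_ge0.
  move=> a b /=; have -> : f' a + g' a - (f' b + g' b) =
    (f' a - f' b) + (g' a - g' b) by ring.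
  by rewrite (le_trans (ler_normD _ _))// mulrDl lerD.
have mfg : measurable_fun setT (f' \+ g) by exact: measurable_funD.
apply: (le_trans (L1_triangle _ mfg _)); [exact: measurable_funD|exact: measurable_funD|].
rewrite [eta in leRHS]splitr EFinD; apply: leeD.
  rewrite (_ : (fun x => _) = (fun x => (`|f x - f' x|)%:E))//.
  by apply/funext => x /=; rewrite opprD addrACA subrr addr0.
rewrite (_ : (fun x => _) = (fun x => (`|g x - g' x|)%:E))//.
by apply/funext => x /=; rewrite opprD addrACA subrr add0r.
Qed.

Lemma lipschitz_approx_lipschitz f (L : R) : measurable_fun setT f -> 0 <= L ->
  (forall a b, `|f a - f b| <= L * `|a - b|) -> lipschitz_approx mu f.
Proof.
move=> mf L0 Lf; split => // eta eta0; exists f; split => //; first by exists L.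
under eq_integral do rewrite subrr normr0.
by rewrite integral0 lee_fin ltW.
Qed.

Lemma lipschitz_approx_cst (c : R) : lipschitz_approx mu (cst c).
Proof.
apply: (@lipschitz_approx_lipschitz _ 0) => // a b.
by rewrite subrr normr0 mul0r.
Qed.

Lemma lipschitz_approxZ (c : R) f : lipschitz_approx mu f ->
  lipschitz_approx mu (fun x => c * f x).
Proof.
have [->|c0] := eqVneq c 0.
  move=> _; rewrite (_ : (fun x => _) = cst 0); first exact: lipschitz_approx_cst.
  by apply/funext => x; rewrite mul0r.
move=> [mf af]; split; first exact: measurable_funM.
have nc : 0 < `|c| by rewrite normr_gt0.
move=> eta eta0.
have [|g [mg [L L0 Lg] fg]] := af (eta / `|c|); first by rewrite divr_gt0.
exists (fun x => c * g x); split; first exact: measurable_funM.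
  exists (`|c| * L); first by rewrite mulr_ge0.
  by move=> a b; rewrite -mulrBr normrM -mulrA ler_wpM2l.
under eq_integral do rewrite -mulrBr normrM EFinM.
rewrite ge0_integralZl_EFin//; last first.
  apply/measurable_EFinP/measurableT_comp => //; exact: measurable_funB.
rewrite (_ : eta%:E = `|c|%:E * (eta / `|c|)%:E)%E; last first.
  by rewrite -EFinM mulrC divfK// gt_eqF.
by apply: lee_wpmul2l => //; rewrite lee_fin.
Qed.

Lemma lipschitz_approx_closed f : measurable_fun setT f ->
  (forall eta, 0 < eta -> exists g, lipschitz_approx mu g /\
     (\int[mu]_x (`|f x - g x|)%:E <= eta%:E)%E) ->
  lipschitz_approx mu f.
Proof.
move=> mf af; split => // eta eta0; have eta2 : 0 < eta / 2 by rewrite divr_gt0.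
have [g [[mg ag] fg]] := af _ eta2.
have [h [mh Lh gh]] := ag _ eta2.
exists h; split => //; apply: (le_trans (L1_triangle mf mg mh)).
by rewrite [eta in leRHS]splitr EFinD; apply: leeD.
Qed.

(** Dominated convergence with the constant 1, integrable since mu is finite. Ramps and indicators,
    the functions it serves, take values in [0, 1]. *)
Lemma lipschitz_approx_limit (f_ : nat -> R -> R) f :
  (forall n, lipschitz_approx mu (f_ n)) -> measurable_fun setT f ->
  (forall n x, `|f_ n x| <= 1) -> (forall x, f_ ^~ x @ \oo --> f x) ->
  lipschitz_approx mu f.
Proof.
move=> af mf f1 fl; apply: lipschitz_approx_closed => // eta eta0.
have [] := @dominated_convergence _ _ _ mu setT measurableT
  (fun n x => (f_ n x)%:E) (EFin \o f) (cst 1%E).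
- by move=> n; apply/measurable_EFinP; have [] := af n.
- exact/measurable_EFinP.
- by apply: aeW => x _; apply: cvg_EFin; [exact: nearW|exact: fl].
- exact: finite_measure_integrable_cst.
- by apply: aeW => x n _ /=; rewrite lee_fin.
move=> _ /ecvg0_le/(_ _ eta0)[N _ HN] _.
exists (f_ N); split => //; have := HN N (leqnn N).
rewrite /=; congr (_ <= _)%E; apply: eq_integral => x _.
by rewrite distrC.
Qed.

(** The ramps [r n] are n-Lipschitz and converge pointwise to the indicator. The half-line is open
    because every ramp is 0 at [a]. *)
Lemma lipschitz_approx_indic_gt (a : R) :
  lipschitz_approx mu (\1_(`]a, +oo[%classic)).
Proof.
pose r (n : nat) (x : R) : R := Num.min 1 (Num.max 0 (n%:R * (x - a))).
have n0 n : 0 <= n%:R :> R by [].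
apply: (@lipschitz_approx_limit r).
- move=> n; apply: (@lipschitz_approx_lipschitz _ n%:R) => //.
    apply: measurable_minr => //; apply: measurable_maxr => //.
    by apply: measurable_funM => //; exact: measurable_funB.
  move=> x y; rewrite -[n%:R in leRHS]ger0_norm// -normrM.
  have -> : n%:R * (x - y) = n%:R * (x - a) - n%:R * (y - a) by ring.
  rewrite /r; move: (n%:R * (x - a)) (n%:R * (y - a)) => u v.
  (* The clamp of [w] to [0, 1] is 0, [w] or 1; in each of the nine combinations for [u] and [v] the
     1-Lipschitz bound is linear arithmetic. *)
  have cl (w : R) : [\/ w <= 0 /\ Num.min 1 (Num.max 0 w) = 0,
      0 <= w <= 1 /\ Num.min 1 (Num.max 0 w) = w |
      1 <= w /\ Num.min 1 (Num.max 0 w) = 1].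
    have [w0|w0] := lerP w 0; first by constructor 1; rewrite min_r.
    have [w1|w1] := lerP w 1; first by constructor 2; rewrite ltW.
    by constructor 3; rewrite ltW.
  rewrite ler_norml; case: (ger0P (u - v)) => ?;
    case: (cl u) => -[? ->]; case: (cl v) => -[? ->]; apply/andP; split; lra.
- exact: measurable_indic.
- move=> n x; rewrite /r ger0_norm ?ge_min ?lexx// le_min ler01 /=.
  by rewrite le_max lexx.
- move=> x; rewrite indicE; have [|] := boolP (x \in _).
    rewrite inE /= in_itv /= andbT => ax.
    apply: cvg_near_cst; near=> n.
    have h : 1 <= n%:R * (x - a).
      rewrite -ler_pdivrMr ?subr_gt0// div1r.
      near: n; exact: nbhs_infty_ger.
    by rewrite /r max_r ?(le_trans _ h)// min_l.
  rewrite notin_setE /= in_itv /= andbT => /negP; rewrite -leNgt => xa.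
  apply: cvg_near_cst; apply: nearW => n; rewrite /r max_l ?min_r//.
  by rewrite mulr_ge0_le0 ?subr_le0.
Unshelve. all: by end_near. Qed.

(** Open half-lines form a pi-system generating the Borel sets, and the admissible sets form a
    Dynkin class: complements are affine combinations, and disjointness makes indicators of finite
    unions into sums before passing to the limit. *)
Lemma lipschitz_approx_indic (A : set R) : measurable A ->
  lipschitz_approx mu (\1_A).
Proof.
move=> mA.
have E : @measurable _ R = <<s @RGenOInfty.G R >> by exact: RGenOInfty.measurableE.
apply: (@dynkin_induction _ R (@RGenOInfty.G R) (fun A => lipschitz_approx mu (\1_A))).
- exact: E.
- move=> _ _ [a ->] [b ->]; exists (Num.max a b).
  apply/seteqP; split => x /=; rewrite !in_itv /= !andbT gt_max.
    by move=> [-> ->].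
  by move=> /andP.
- by rewrite indicT; exact: lipschitz_approx_cst.
- by move=> _ [a ->]; exact: lipschitz_approx_indic_gt.
- move=> S mS aS.
  rewrite (_ : \1_(~` S) = cst 1 \+ (fun x => -1 * \1_S x)); last first.
    apply/funext => x /=; rewrite !indicE in_setC.
    by case: (x \in S) => /=; rewrite mulN1r ?subrr ?subr0.
  exact: (lipschitz_approxD (lipschitz_approx_cst 1) (lipschitz_approxZ (-1) aS)).
- move=> F mF tF aF.
  apply: (@lipschitz_approx_limit (fun n => \1_(\big[setU/set0]_(k < n) F k))).
  + elim=> [|n IH]; first by rewrite big_ord0 indic0; exact: lipschitz_approx_cst.
    rewrite big_ord_recr /=.
    rewrite (_ : \1_(_ `|` _) = \1_(\big[setU/set0]_(k < n) F k) \+ \1_(F n)).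
      exact: lipschitz_approxD.
    apply/funext => x /=; rewrite !indicE in_setU.
    have [/set_mem xF|_] := boolP (x \in F n); last by rewrite orbF addr0.
    suff /negbTE -> : x \notin \big[setU/set0]_(k < n) F k by rewrite orbT add0r.
    apply/negP => /set_mem; rewrite -bigcup_mkord => -[k /= kn Fk].
    have Ekn : k = n by apply: (tF k n I I); exists x.
    by move: kn; rewrite Ekn ltnn.
  + by apply: measurable_indic; exact: bigcup_measurable.
  + by move=> n x; rewrite indicE normr_nat lern1 leq_b1.
  + move=> x; rewrite indicE; have [/set_mem[k _ Fk]|xF] := boolP (x \in _).
      apply: cvg_near_cst; near=> n; rewrite indicE mem_set// -bigcup_mkord.
      by exists k => //=; near: n; exact: nbhs_infty_gt.
    apply: cvg_near_cst; apply: nearW => n; rewrite indicE memNset//.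
    by rewrite -bigcup_mkord => -[k /= kn Fk]; move/negP: xF; apply; apply/mem_set; exists k.
- by rewrite -E.
Unshelve. all: by end_near. Qed.

Import HBSimple.

(** Simple functions are dense in L1(mu) and are finite combinations of indicators. *)
Lemma lipschitz_approx_integrable f : mu.-integrable setT (EFin \o f) ->
  lipschitz_approx mu f.
Proof.
move=> intf; have mf : measurable_fun setT f.
  by apply/measurable_EFinP; exact: measurable_int intf.
apply: lipschitz_approx_closed => // eta eta0.
have [//|g [_ _ /ecvg0_le/(_ _ eta0)[N _ HN]]] := approximation_sfun_integrable _ intf.
exists (g N); split; last exact: (HN N (leqnn N)).
have [s Es] : exists s : seq R,
    (g N : R -> R) = fun x => \sum_(y <- s) y * \1_(g N @^-1` [set y]) x.
  by eexists; apply/funext => x; rewrite fimfunE fsbig_finite.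
rewrite Es; elim: s {Es} => [|y s IH].
  by under eq_fun do rewrite big_nil; exact: lipschitz_approx_cst.
under eq_fun do rewrite big_cons.
apply: lipschitz_approxD => //.
by apply: lipschitz_approxZ; exact: lipschitz_approx_indic.
Qed.

End lipschitz_density.


(** * Identification of pointwise limits of ball averages *)

Lemma near_le_limn_einf {R : realType} (u : (\bar R)^nat) (c : \bar R) :
  (\forall n \near \oo, (c <= u n)%E) -> (c <= limn_einf u)%E.
Proof.
move=> [N _ HN]; rewrite limn_einf_lim; apply: lime_ge; first exact: is_cvg_einfs.
exists N => // n /= Nn; apply: le_ereal_inf_tmp => _ [k /= nk <-].
by apply: HN; rewrite /= (leq_trans Nn).
Qed.

Lemma ecvg0_ge0 {R : realType} (u : (\bar R)^nat) : (forall n, (0 <= u n)%E) ->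
  (forall eta : R, 0 < eta -> \forall n \near \oo, (u n <= eta%:E)%E) ->
  u @ \oo --> 0%E.
Proof.
move=> u0 us; apply/fine_cvgP; split.
  apply: filterS (us 1 ltr01) => n un.
  by rewrite ge0_fin_numE// (le_lt_trans un)// ltry.
apply/cvgrPdist_le => eta eta0; apply: filterS (us eta eta0) => n un.
rewrite /= sub0r normrN ger0_norm ?fine_ge0// -lee_fin fineK//.
by rewrite ge0_fin_numE// (le_lt_trans un)// ltry.
Qed.

Section ball_average_limit.
Context {R : realType}.
Variable mu : {finite_measure set R -> \bar R}.
Implicit Types (e x y : R) (f g : R -> R).

Lemma ball_average_osc e f x : mu.-integrable setT (EFin \o f) ->
  0 < fine (mu (cball x e)) ->
  ((`|(\int[mu]_(y in cball x e) f y) / fine (mu (cball x e)) - f x|)%:E <=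
     osc mu e f x)%E.
Proof.
move=> intf; set c := fine _ => c0.
have mB := measurable_cball x e.
have intB : mu.-integrable (cball x e) (EFin \o f).
  exact: integrableS intf.
have intc : mu.-integrable (cball x e) (EFin \o cst (f x)).
  exact: finite_measure_integrable_cst.
have intd : mu.-integrable (cball x e) (EFin \o (fun y => f y - f x)).
  by have := integrableB mB intB intc.
have -> : (\int[mu]_(y in cball x e) f y) / c - f x =
          c^-1 * \int[mu]_(y in cball x e) (f y - f x).
  rewrite RintegralB// Rintegral_cst// -/c.
  by field; rewrite gt_eqF.
rewrite normrM ger0_norm ?invr_ge0 ?(ltW c0)//.
apply: (@le_trans _ _ (c^-1 * \int[mu]_(y in cball x e) `|f y - f x|)%:E).
  by rewrite lee_fin ler_wpM2l ?invr_ge0 ?(ltW c0)// le_normr_Rintegral.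
rewrite /osc EFinM /Rintegral fineK; last first.
  apply: integrable_fin_num => //.
  by have := integrable_abse intd.
rewrite integral_mkcond -ge0_integralZl_EFin//; last 3 first.
- by move=> y _; apply: erestrict_ge0 => // z _ /=; rewrite lee_fin.
- apply/(measurable_restrictT _ _).1 => //.
  by have /measurable_int := integrable_abse intd.
- by rewrite invr_ge0 ltW.
apply: ge0_le_integral => //.
- move=> y _; rewrite mule_ge0// ?lee_fin ?invr_ge0 ?(ltW c0)//.
  by apply: erestrict_ge0 => // z _ /=; rewrite lee_fin.
- apply: measurable_funeM; apply/(measurable_restrictT _ _).1 => //.
  by have /measurable_int := integrable_abse intd.
- have mf : measurable_fun setT f.
    by apply/measurable_EFinP; exact: measurable_int intf.
  exact: (measurableT_comp (measurable_osc_kernel mu e mf) (pair1_measurable x)).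
move=> y _; rewrite patchE /avg_kernel indicE -xsection_strip mem_xsection.
have [_|_] := boolP ((x, y) \in strip e); rewrite /= ?mulr1 ?mulr0 ?mul0r ?mule0//=.
by rewrite xsection_strip -EFinM.
Qed.

(** The integrals of [osc] tend to 0, so its lower limit vanishes almost everywhere. A lower limit
    is enough because the averages are assumed to converge: if they tended to a value other than
    [f x], the oscillation would stay away from 0. *)
Lemma ball_average_limit f m (E : set R) : mu.-integrable setT (EFin \o f) ->
  measurable E -> mu (~` E) = 0%E ->
  (forall x, E x -> forall e, 0 < e -> 0 < fine (mu (cball x e))) ->
  (forall x, E x ->
     (fun n : nat => (\int[mu]_(y in cball x n.+1%:R^-1) f y) /
        fine (mu (cball x n.+1%:R^-1))) @ \oo --> m x) ->
  {ae mu, forall x, f x = m x}.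
Proof.
move=> intf mE muE supp lim_avg.
have mf : measurable_fun setT f.
  by apply/measurable_EFinP; exact: measurable_int intf.
pose G (n : nat) x := osc mu n.+1%:R^-1 f x.
have mG n : measurable_fun setT (G n) by exact: measurable_osc.
have G0 n x : (0 <= G n x)%E by exact: osc_ge0.
have intG : (fun n => \int[mu]_x G n x)%E @ \oo --> 0%E.
  apply: ecvg0_ge0 => [n|eta eta0]; first exact: integral_ge0.
  have [e0 e00 He] := int_osc_small (lipschitz_approx_integrable intf) eta0.
  near=> n; apply: He; first by rewrite invr_ge0.
  apply: ltW; near: n; exact: (near_infty_natSinv_lt (PosNum e00)).
have lim0 : (\int[mu]_x limn_einf (G ^~ x) = 0)%E.
  apply/eqP; rewrite eq_le; apply/andP; split.
    rewrite -[leRHS](cvg_limn_einf_sup intG).1.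
    by apply: fatou => // n x _.
  by apply: integral_ge0 => x _; apply: near_le_limn_einf; exact: nearW.
have lG0 x : (0 <= limn_einf (G ^~ x))%E.
  by apply: near_le_limn_einf; exact: nearW.
have mlG : measurable_fun setT (fun x => limn_einf (G ^~ x)).
  under eq_fun do rewrite limn_einf_lim.
  apply: (emeasurable_fun_cvg (fun n x => einfs (G ^~ x) n)).
  - exact: measurable_fun_einfs.
  - by move=> x _; exact: is_cvg_einfs.
have : ae_eq mu setT (fun x => limn_einf (G ^~ x)) (cst 0%E).
  apply/ae_eq_integral_abs => //.
  by under eq_integral do rewrite gee0_abs//.
have aeE : {ae mu, forall x, E x}.
  by exists (~` E); split => //; exact: measurableC.
apply: filterS2 aeE => x Ex /(_ I) Gx0; apply/eqP; rewrite -subr_eq0 -normr_le0.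
rewrite leNgt; apply/negP => d0.
(* Once the averages are within half of |f x - m x| of [m x], they are at least that half away from
   [f x]. *)
suff : ((`|f x - m x| / 2)%:E <= limn_einf (G ^~ x))%E.
  by rewrite Gx0 lee_fin leNgt divr_gt0.
apply: near_le_limn_einf.
have := lim_avg x Ex; move/cvgrPdist_le => /(_ (`|f x - m x| / 2)).
rewrite divr_gt0// => /(_ isT); apply: filterS => n.
move=> h; apply: le_trans (ball_average_osc intf _); last exact: supp.
rewrite lee_fin.
set a := _ / _ in h *.
have := ler_distD a (f x) (m x); rewrite (distrC (f x) a) (distrC a (m x)).
move: h; set d := `|f x - m x|; set d1 := `|m x - a|; set d2 := `|a - f x|.
lra.
Unshelve. all: by end_near. Qed.

End ball_average_limit.


(** * Conditional means as limits over balls *)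

Lemma integral_mrestr d (T : measurableType d) (R : realType)
    (P : {measure set T -> \bar R}) (S : set T) (mS : measurable S)
    (A : set T) (f : T -> \bar R) : measurable A -> measurable_fun setT f ->
  (mrestr P mS).-integrable A f ->
  (\int[mrestr P mS]_(w in A) f w = \int[P]_(w in A `&` S) f w)%E.
Proof.
move=> mA mf intf.
rewrite (@negligible_integral _ _ _ _ A (~` S))//; last 2 first.
- exact: measurableC.
- by rewrite /= /mrestr setICl.
rewrite setDE setCK; apply: eq_measure_integral => B mB BS.
rewrite /= /mrestr setIidl//; exact: subset_trans BS (@subIsetr _ _ _).
Qed.

Section law_on.
Context d {T : measurableType d} {R : realType}.
Variables (P : {finite_measure set T -> \bar R}) (S : set T) (mS : measurable S).
Variables (D : T -> R).

Lemma measurable_preimageT A : measurable_fun setT D -> measurable A ->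
  measurable (D @^-1` A).
Proof. by move=> mD mA; rewrite -[X in measurable X]setTI; exact: mD. Qed.

(** Not normalised by the mass of [S]: the mass of a ball is then the denominator of the conditional
    mean over it. *)
Definition law_on (mD : measurable_fun setT D) : set R -> \bar R :=
  pushforward (mrestr P mS) D.

Variable mD : measurable_fun setT D.

Let law0 : law_on mD set0 = 0%E.
Proof. by rewrite /law_on /pushforward preimage_set0 measure0. Qed.

Let law_ge0 A : (0 <= law_on mD A)%E. Proof. exact: measure_ge0. Qed.

Let law_sigma_additive : semi_sigma_additive (law_on mD).
Proof.
move=> F mF tF mUF; rewrite /law_on /pushforward preimage_bigcup.
apply: measure_semi_sigma_additive.
- by move=> n; exact: measurable_preimageT.
- apply/trivIsetP => /= i j _ _ ij; rewrite -preimage_setI.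
  by move/trivIsetP : tF => /(_ _ _ _ _ ij) ->//; rewrite preimage_set0.
- by rewrite -preimage_bigcup; exact: measurable_preimageT.
Qed.

HB.instance Definition _ := isMeasure.Build _ _ _ (law_on mD)
  law0 law_ge0 law_sigma_additive.

Let law_fin : fin_num_fun (law_on mD).
Proof.
by move=> A mA; apply: fin_num_measure; exact: measurable_preimageT.
Qed.

HB.instance Definition _ := Measure_isFinite.Build _ _ _ (law_on mD) law_fin.

Lemma integral_law_on (f : R -> \bar R) A : measurable A ->
  measurable_fun setT f -> (law_on mD).-integrable setT f ->
  (\int[law_on mD]_(x in A) f x = \int[P]_(w in D @^-1` A `&` S) f (D w))%E.
Proof.
move=> mA mf intf.
have mfD : measurable_fun setT (f \o D) by exact: measurableT_comp.
have intfD : (mrestr P mS).-integrable setT (f \o D).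
  apply/integrableP; split => //; move/integrableP : intf => [_].
  rewrite [X in (X < _)%E](_ : _ = \int[mrestr P mS]_w `|f (D w)|)%E//.
  apply: (@ge0_integral_pushforward _ _ _ _ _ _ mD (mrestr P mS) setT (abse \o f)) => //.
    exact: measurableT_comp.
  by move=> y _; exact: abse_ge0.
have mDA := measurable_preimageT mD mA.
have intA : (mrestr P mS).-integrable (D @^-1` A) (f \o D).
  exact: integrableS intfD.
rewrite -(integral_mrestr mDA mfD intA).
exact: (integral_pushforward mD mf intA mA).
Qed.

End law_on.

Lemma within_continuous_bounded (R : realType) (a b : R) (m : R -> R) :
  {within `[a, b], continuous m} ->
  exists2 C, 0 <= C & forall x, x \in `[a, b] -> `|m x| <= C.
Proof.
move=> mc.
have [M [_ HM]] := compact_bounded (continuous_compact mc (@segment_compact _ a b)).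
exists (Num.max 0 (M + 1)); first by rewrite le_max lexx.
move=> x xab; rewrite le_max; apply/orP; right.
by apply: (HM (M + 1)); [rewrite ltrDl|exists x].
Qed.

Lemma within_continuous_measurable_patch (R : realType) (a b : R) (m : R -> R) :
  {within `[a, b], continuous m} -> measurable_fun setT (m \_ `[a, b]).
Proof.
move=> mc; apply/(measurable_restrictT _ _).1 => //.
exact: subspace_continuous_measurable_fun.
Qed.

(** * Conditional means recovered from limits over balls *)

Section conditional_mean.
Context d {T : measurableType d} {R : realType}.
Variables (P : {finite_measure set T -> \bar R}) (S : set T) (mS : measurable S).
Variables (D X : T -> R) (mD : measurable_fun setT D).

(** The signed measure A |-> E[X; S, D in A]; a charge and not a measure, since [X] may change
    sign. *)
Definition charge_on (intX : P.-integrable setT ((EFin \o X) \_ S))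
  (mD : measurable_fun setT D) : set R -> \bar R :=
  pushforward (induced_charge intX) D.

Hypothesis intX : P.-integrable setT ((EFin \o X) \_ S).

Let charge0 : charge_on intX mD set0 = 0%E.
Proof. by rewrite /charge_on /pushforward preimage_set0 charge0. Qed.

Let charge_finite A : measurable A -> charge_on intX mD A \is a fin_num.
Proof.
move=> mA; have mDA := measurable_preimageT mD mA.
exact: (integrable_fin_num _ (integrableS measurableT mDA (@subsetT _ _) intX)).
Qed.

Let charge_sigma_additive : semi_sigma_additive (charge_on intX mD).
Proof.
move=> F mF tF mUF; rewrite /charge_on /pushforward preimage_bigcup.
apply: charge_semi_sigma_additive.
- by move=> n; exact: measurable_preimageT.
- apply/trivIsetP => /= i j _ _ ij; rewrite -preimage_setI.
  by move/trivIsetP : tF => /(_ _ _ _ _ ij) ->//; rewrite preimage_set0.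
- by rewrite -preimage_bigcup; exact: measurable_preimageT.
Qed.

HB.instance Definition _ := isCharge.Build _ _ _ (charge_on intX mD)
  charge0 charge_finite charge_sigma_additive.

Lemma charge_onE A :
  charge_on intX mD A = (\int[P]_(w in D @^-1` A `&` S) (X w)%:E)%E.
Proof. by rewrite /charge_on /pushforward /induced_charge -integral_mkcondr. Qed.

Lemma charge_on_dominates : charge_on intX mD `<< law_on P mS mD.
Proof.
apply/null_content_dominatesP => A mA PA0.
have {}PA0 : P (D @^-1` A `&` S) = 0%E by exact: PA0.
transitivity (charge_on intX mD A) => //.
rewrite charge_onE (_ : integral _ _ _ =
    \int[P]_(w in D @^-1` A `&` S) ((EFin \o X) \_ S) w)%E; last first.
  by apply: eq_integral => w /set_mem[_ Sw]; rewrite patchE mem_set.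
apply: null_set_integral => //.
  by apply: measurableI => //; exact: measurable_preimageT.
by apply: measurable_funTS; exact: measurable_int intX.
Qed.

(** The ratios are the ball averages of the density of the charge with respect to the law of [D], so
    this density equals [m] almost everywhere. The identity then holds for all Borel [A] at once. *)
Lemma integral_of_symmetric_limit (a b : R) (m : R -> R) :
  (forall w, S w -> a <= D w <= b) ->
  {within `[a, b], continuous m} ->
  (forall x, a <= x <= b -> forall e : R, 0 < e ->
     0 < fine (P (D @^-1` cball x e `&` S))) ->
  (forall x, a <= x <= b ->
     (fun e => (\int[P]_(w in D @^-1` cball x e `&` S) X w) /
       fine (P (D @^-1` cball x e `&` S))) @ 0^'+ --> m x) ->
  forall A, measurable A ->
  (\int[P]_(w in D @^-1` A `&` S) (X w)%:E =
   \int[P]_(w in D @^-1` A `&` S) (m (D w))%:E)%E.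
Proof.
move=> Sab mc supp lim_avg A mA.
pose mu := law_on P mS mD; pose nu := charge_on intX mD.
have numu : nu `<< mu by exact: charge_on_dominates.
pose f := Radon_Nikodym nu mu.
have ffin x : f x \is a fin_num by exact: Radon_Nikodym_fin_num.
have intf : mu.-integrable setT f by exact: Radon_Nikodym_integrable.
have nuE B : measurable B -> nu B = (\int[mu]_(x in B) f x)%E.
  by move=> mB; exact: Radon_Nikodym_integral.
pose mt := m \_ `[a, b].
have mmt : measurable_fun setT mt by exact: within_continuous_measurable_patch.
have [C C0 HC] := within_continuous_bounded mc.
have intmt : mu.-integrable setT (EFin \o mt).
  apply: measurable_bounded_integrable => //.
    by rewrite ltey_eq fin_num_measure.
  exists C; split; first exact: num_real.
  move=> K CK x _ /=; rewrite /mt patchE; case: ifPn => [|_].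
    by rewrite inE => /HC /le_trans; apply; exact: ltW.
  by rewrite normr0 (le_trans C0)// ltW.
have fineE : EFin \o (fine \o f) = f by apply/funext => x /=; rewrite fineK.
have fmt : {ae mu, forall x, (fine \o f) x = mt x}.
  apply: (@ball_average_limit _ _ _ _ `[a, b]%classic).
  - by rewrite fineE.
  - exact: measurable_itv.
  - transitivity (P (D @^-1` (~` `[a, b]) `&` S)) => //.
    rewrite (_ : _ `&` _ = set0) ?measure0//.
    by apply/seteqP; split => // w [/= + /Sab]; rewrite in_itv /=.
  - move=> x; rewrite /= in_itv /= => xab e e0; exact: supp.
  - move=> x; rewrite /= in_itv /= => xab.
    rewrite /mt patchE mem_set//.
    have h (n : nat) : \int[mu]_(y in cball x n.+1%:R^-1) (fine \o f) y =
        \int[P]_(w in D @^-1` cball x n.+1%:R^-1 `&` S) X w.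
      rewrite /Rintegral -charge_onE -/nu nuE; last exact: measurable_cball.
      by under eq_integral do rewrite fineK//.
    under eq_fun do rewrite h.
    (* Only the radii 1 / (n + 1) are used, as Fatou's lemma works along a sequence. *)
    have /cvg_at_rightP/(_ (fun n => n.+1%:R^-1)) := lim_avg x xab.
    apply; split => [n|]; first by rewrite invr_gt0.
    exact: cvg_harmonic.
rewrite -charge_onE -/nu nuE//.
transitivity (\int[mu]_(x in A) (EFin \o mt) x)%E.
  apply: ae_eq_integral => //.
  - by apply: measurable_funTS; exact: measurable_int intf.
  - by apply/measurable_EFinP/measurable_funTS.
  - by apply: filterS fmt => x /= <- _; rewrite fineK.
rewrite integral_law_on//; last exact/measurable_EFinP.
apply: eq_integral => w /set_mem[_ Sw] /=.
by rewrite /mt patchE mem_set//= in_itv /= Sab.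
Qed.

End conditional_mean.


(** * Layer-cake formula *)

Section layer_cake.
Context d {T : measurableType d} {R : realType}.
Variables (P : {finite_measure set T -> \bar R}) (S : set T) (mS : measurable S).
Variables (D h : T -> R) (mD : measurable_fun setT D).
Hypothesis inth : P.-integrable setT ((EFin \o h) \_ S).
Variables (a b : R) (phi : R -> R).
Hypothesis Sab : forall w, S w -> a <= D w <= b.
Hypothesis phic : {within `[a, b], continuous phi}.

Local Notation leb := (@lebesgue_measure R).
Local Notation RL := (measurableTypeR R).

(** The integrand for Fubini: extended by 0 outside [S] and [a, b], so that both iterated integrals
    run over full spaces. *)
Let F (z : T * RL) : R :=
  (h \_ S) z.1 * (phi \_ `[a, b]) z.2 * \1_[set z : T * RL | z.2 <= D z.1] z.

Let mhS : measurable_fun setT (h \_ S).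
Proof.
by apply/measurable_EFinP; rewrite -restrict_EFin; exact: measurable_int inth.
Qed.

Let mphi : measurable_fun setT (phi \_ `[a, b]).
Proof. exact: within_continuous_measurable_patch. Qed.

Let mF : measurable_fun setT F.
Proof.
apply: measurable_funM; first apply: measurable_funM.
- exact: (measurableT_comp mhS measurable_fst).
- exact: (measurableT_comp mphi measurable_snd).
apply: measurable_indic.
have m : measurable_fun setT (fun z : T * RL => z.2 <= D z.1).
  apply: measurable_fun_ler; first exact: measurable_snd.
  exact: (measurableT_comp mD measurable_fst).
rewrite -[X in measurable X]setTI.
exact: (m measurableT [set true]).
Qed.

(** If |phi| <= C on [a, b], the inner integral is at most C |b - a| |h|. The absolute value keeps
    this bound nonnegative without an order between [a] and [b]. *)
Let intF : (P \x leb)%E.-integrable setT (EFin \o F).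
Proof.
have [C C0 HC] := within_continuous_bounded phic.
apply/integrable12ltyP; first exact/measurable_EFinP.
apply: (@le_lt_trans _ _ (\int[P]_w ((C * `|b - a|)%:E * (`|(h \_ S) w|)%:E))%E).
  apply: ge0_le_integral => //.
  - by move=> w _; apply: integral_ge0 => l _; rewrite lee_fin.
  - apply: (measurable_fun_fubini_tonelli_F (fun z => `|(EFin \o F) z|%E)) => //.
    by apply: measurableT_comp => //; exact/measurable_EFinP.
  - by apply/measurable_EFinP/measurable_funM => //; exact: measurableT_comp.
  move=> w _.
  apply: (@le_trans _ _ (\int[leb]_(l in `[a, b]) (cst (C * `|(h \_ S) w|)%:E l))%E).
    rewrite [leRHS]integral_mkcond; apply: ge0_le_integral => //.
    - apply: measurableT_comp => //; apply/measurable_EFinP.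
      exact: (measurableT_comp mF (pair1_measurable w)).
    - by apply/(measurable_restrictT _ _).1.
    move=> l _; rewrite [leRHS]patchE /F /= [(phi \_ _) _]patchE indicE.
    case: ifPn => [/set_mem lab|_]; last by rewrite mulr0 mul0r normr0.
    rewrite lee_fin !normrM [`|(_ \in _)%:R|]ger0_norm//.
    rewrite -[leRHS]mulr1 ler_pM// ?mulr_ge0//; last by rewrite lern1 leq_b1.
    by rewrite mulrC ler_wpM2r// HC.
  rewrite integral_cst//= lebesgue_measure_itv /=.
  case: ifPn => _; last by rewrite mule0 mule_ge0 ?lee_fin ?mulr_ge0.
  by rewrite -EFinD -!EFinM lee_fin mulrAC ler_wpM2r// ler_wpM2l// ler_norm.
rewrite ge0_integralZl_EFin//; last 2 first.
- by apply/measurable_EFinP; exact: measurableT_comp.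
- by rewrite mulr_ge0.
have /integrableP[_] := inth; rewrite restrict_EFin => hfin.
rewrite lte_mul_pinfty ?lee_fin ?mulr_ge0//.
Qed.

Let mE l : measurable [set w | l <= D w].
Proof.
rewrite (_ : [set w | _] = D @^-1` `[l, +oo[); first exact: measurable_preimageT.
by apply/seteqP; split => w /=; rewrite in_itv /= andbT.
Qed.

Lemma integrable_patchI (A : set T) : measurable A ->
  P.-integrable setT ((EFin \o h) \_ (S `&` A)).
Proof.
move=> mA; rewrite setIC patch_setI; apply: (integrable_mkcond _ mA).1.
exact: integrableS inth.
Qed.

Lemma Rintegral_EFin (A : set T) : measurable A ->
  (\int[P]_(w in S `&` A) h w)%:E = (\int[P]_(w in S `&` A) (h w)%:E)%E.
Proof.
move=> mA; rewrite /Rintegral fineK//; apply: integrable_fin_num.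
  exact: measurableI.
apply/integrable_mkcond; first exact: measurableI.
exact: integrable_patchI.
Qed.

Let intF_l l : (\int[P]_w (F (w, l))%:E =
  ((phi \_ `[a, b]) l * \int[P]_(w in S `&` [set w | l <= D w]) h w)%:E)%E.
Proof.
rewrite EFinM Rintegral_EFin//.
rewrite [in RHS]integral_mkcond -integralZl//; last exact: integrable_patchI.
apply: eq_integral => w _.
rewrite /F /= indicE [X in (_ * X)%E]patchE [(h \_ S) w]patchE.
have -> : ((w, l) \in [set z : T * RL | z.2 <= D z.1]) = (l <= D w).
  by apply/idP/idP; rewrite inE.
rewrite in_setI; case: ifPn => _ /=; last by rewrite mul0r mul0r mule0.
have -> : (w \in [set w0 | l <= D w0]) = (l <= D w).
  by apply/idP/idP; rewrite inE.
by case: ifPn => _ /=; rewrite ?mulr1 ?mulr0 ?mule0// -EFinM mulrC.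
Qed.

Let intphi x : x <= b -> leb.-integrable `[a, x] (EFin \o phi).
Proof.
move=> xb.
have intab : leb.-integrable `[a, b] (EFin \o phi).
  by apply: continuous_compact_integrable => //; exact: segment_compact.
apply: integrableS intab => //.
by apply: subset_itvl; rewrite bnd_simp.
Qed.

Let intF_w w : S w -> (\int[leb]_l (F (w, l))%:E =
  (h w * \int[leb]_(l in `[a, D w]) phi l)%:E)%E.
Proof.
move=> Sw; have /andP[aD Db] := Sab Sw.
rewrite EFinM /Rintegral fineK; last first.
  by apply: integrable_fin_num => //; exact: intphi.
rewrite [in RHS]integral_mkcond -integralZl//; last first.
  have mI : measurable (`[a, D w]%classic : set RL) by exact: measurable_itv.
  exact: ((integrable_mkcond _ mI).1 (intphi Db)).
apply: eq_integral => l _.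
rewrite /F /= indicE !patchE mem_set//.
have -> : ((w, l) \in [set z : T * RL | z.2 <= D z.1]) = (l <= D w).
  by apply/idP/idP; rewrite inE.
have -> : (l \in `[a, D w]%classic) = (l \in `[a, b]%classic) && (l <= D w).
  rewrite !mem_setE !in_itv /= -andbA; congr andb.
  by case: (leP l (D w)) => [lD|_]; rewrite ?andbF// andbT (le_trans lD).
case: (_ \in _) => /=; last by rewrite mulr0 mul0r mule0.
by case: (l <= D w); rewrite ?mulr1 ?mulr0 ?mule0// -EFinM.
Qed.

Lemma layer_cake :
  (\int[P]_(w in S) (h w * \int[leb]_(l in `[a, D w]) phi l)%:E =
   \int[leb]_(l in `[a, b])
     (phi l * \int[P]_(w in S `&` [set w | l <= D w]) h w)%:E)%E.
Proof.
transitivity (\int[P]_w \int[leb]_l (EFin \o F) (w, l))%E.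
  rewrite integral_mkcond; apply: eq_integral => w _.
  rewrite patchE; case: ifPn => [/set_mem Sw|Sw]; first by rewrite /= intF_w.
  rewrite [RHS]integral0_eq// => l _.
  by rewrite /F /= [in LHS]patchE (negbTE Sw) !mul0r.
rewrite (Fubini intF) [RHS]integral_mkcond; apply: eq_integral => l _.
rewrite /= intF_l !patchE; case: ifPn => // _; by rewrite mul0r.
Qed.

(** Bounded by C E[|h|; S] on an interval of finite length. Weights such as [w1_across] are
    differences, and splitting their integrals requires each part to be integrable. *)
Lemma integrable_layer : leb.-integrable `[a, b]
  (fun l => (phi l * \int[P]_(w in S `&` [set w | l <= D w]) h w)%:E).
Proof.
have [C C0 HC] := within_continuous_bounded phic.
have leb_fin : (leb `[a, b]%classic < +oo)%E.
  by rewrite lebesgue_measure_itv /=; case: ifPn => _; rewrite ?ltry// -EFinD ltry.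
apply: measurable_bounded_integrable => //.
- apply/measurable_EFinP.
  apply: (@eq_measurable_fun _ _ _ _ _ (fun l => \int[P]_w (F (w, l))%:E)%E).
    by move=> l lab; rewrite intF_l patchE lab.
  by apply: measurable_funTS; exact: (measurable_fubini_G intF).
have intS : P.-integrable S (EFin \o h) by apply/integrable_mkcond.
exists (C * \int[P]_(w in S) `|h w|); split; first exact: num_real.
move=> K CK l /= lab; apply: (le_trans _ (ltW CK)).
have intSE : P.-integrable (S `&` [set w | l <= D w]) (EFin \o h).
  apply: integrableS intS => //; exact: measurableI.
rewrite normrM ler_pM ?HC//.
apply: (le_trans (le_normr_Rintegral (measurableI _ _ mS (mE l)) intSE)).
apply: fine_le.
- apply: integrable_fin_num; first exact: measurableI.
  by have := integrable_abse intSE.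
- by apply: integrable_fin_num => //; have := integrable_abse intS.
apply: ge0_subset_integral => //; first exact: measurableI.
by have /measurable_int := integrable_abse intS.
Qed.

End layer_cake.


(** * Derivatives relative to the dose interval *)

Section one_sided_derivative.
Context {d : measure_display} {T : measurableType d} {R : realType}.
Variable M : model T R.
Hypothesis dLU : dL M < dU M.
Implicit Types (f g : R -> R) (x v : R).

Lemma dq_cvgP f x v : dq f x @ within (inDp M) x^' --> v <->
  forall e : R, 0 < e -> exists2 del : R, 0 < del &
    forall y, inDp M y -> y != x -> `|y - x| < del -> `|v - dq f x y| <= e.
Proof.
split => [/cvgrPdist_le H e e0|H].
  have := H e e0; rewrite !near_withinE => /nbhs_ballP[del /= del0 Hd].
  exists del => // y Dy yx yd; apply: Hd => //.
  by rewrite /ball /= distrC.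
apply/cvgrPdist_le => e e0; have [del del0 Hd] := H e e0.
rewrite !near_withinE; apply/nbhs_ballP; exists del => // y yd yx Dy.
by apply: Hd => //; move: yd; rewrite /ball /= distrC.
Qed.

(** As dL < dU, each dose is a limit of other doses, from the right below dU and from the left at
    dU. Limits of difference quotients are therefore unique, and [deriv_Dp] takes the expected
    value. *)
Lemma within_inDp_proper x : inDp M x -> ProperFilter (within (inDp M) x^').
Proof.
rewrite /inDp => /andP[Lx xU]; apply: Build_ProperFilter_ex => A; rewrite /within /= => /nbhs_ballP[del /= del0 H].
have [Hx|Hx] := ltP x (dU M).
- pose y := Num.min (x + del / 2) (dU M).
  have : [/\ x < y, y <= dU M & y <= x + del / 2].
    by rewrite /y lt_min Hx ltrDl divr_gt0// !ge_min !lexx orbT.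
  move=> [h1 h2 h3]; exists y; apply: H.
  + by rewrite /ball /= ltr_norml; apply/andP; split; lra.
  + by rewrite gt_eqF.
  + by rewrite h2 (le_trans Lx)// ltW.
- pose y := Num.max (x - del / 2) (dL M).
  have Lx' : dL M < x by rewrite (lt_le_trans dLU).
  have : [/\ y < x, dL M <= y & x - del / 2 <= y].
    by rewrite /y gt_max Lx' ltrBlDr ltrDl divr_gt0// !le_max !lexx orbT.
  move=> [h1 h2 h3]; exists y; apply: H.
  + by rewrite /ball /= ltr_norml; apply/andP; split; lra.
  + by rewrite lt_eqF.
  + by rewrite h2 (le_trans (ltW h1)).
Qed.

Lemma deriv_DpE f x v : inDp M x -> dq f x @ within (inDp M) x^' --> v ->
  deriv_Dp M f x = v.
Proof.
by move=> Dx; have := within_inDp_proper Dx; move=> ? fv; apply: cvg_lim.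
Qed.

Lemma C1_Dp_deriv f : C1_Dp M f ->
  {within `[dL M, dU M], continuous (deriv_Dp M f)} /\
  forall x, inDp M x -> dq f x @ within (inDp M) x^' --> deriv_Dp M f x.
Proof.
move=> [f' [f'c ff']]; have E x : inDp M x -> deriv_Dp M f x = f' x.
  by move=> Dx; apply: deriv_DpE => //; exact: ff'.
split; last by move=> x Dx; rewrite E//; exact: ff'.
have ff : {in `[dL M, dU M]%classic, f' =1 deriv_Dp M f}.
  by move=> x; rewrite inE /= in_itv /= => Dx; rewrite E.
exact: (subspace_eq_continuous ff f'c).
Qed.

(** Since [h] is prescribed only on the dose interval, this one statement serves for sums, for
    scalings and shifts (c' = 0), and for replacing a function by one that agrees with it on the
    doses. *)
Lemma C1_Dp_lin f g (c c' c0 : R) h : C1_Dp M f -> C1_Dp M g ->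
  (forall x, inDp M x -> h x = c * f x + c' * g x + c0) ->
  C1_Dp M h /\
  forall x, inDp M x ->
    deriv_Dp M h x = c * deriv_Dp M f x + c' * deriv_Dp M g x.
Proof.
move=> /C1_Dp_deriv[fc fd] /C1_Dp_deriv[gc gd] hE.
have hd x : inDp M x -> dq h x @ within (inDp M) x^' -->
    c * deriv_Dp M f x + c' * deriv_Dp M g x.
  move=> Dx.
  have H : (fun y => c * dq f x y + c' * dq g x y) @ within (inDp M) x^' -->
      c * deriv_Dp M f x + c' * deriv_Dp M g x.
    by apply: cvgD; apply: cvgMr; [exact: fd|exact: gd].
  apply: cvg_trans H; apply: near_eq_cvg.
  rewrite near_withinE; apply: filterE => y Dy.
  by rewrite /dq !hE//; ring.
split; last by move=> x Dx; apply: deriv_DpE => //; exact: hd.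
exists (fun x => c * deriv_Dp M f x + c' * deriv_Dp M g x); split => //.
by move=> x; apply: cvgD; apply: cvgMr; [exact: fc|exact: gc].
Qed.

Lemma dq_cvg_continuous f x v : dq f x @ within (inDp M) x^' --> v ->
  forall e : R, 0 < e -> exists2 del : R, 0 < del &
    forall y, inDp M y -> `|y - x| < del -> `|f x - f y| <= e.
Proof.
move=> /dq_cvgP/(_ 1 ltr01)[d1 d10 H] e e0.
have c0 : 0 < `|v| + 1 by rewrite ltr_wpDl.
exists (Num.min d1 (e / (`|v| + 1))); first by rewrite lt_min d10 divr_gt0.
move=> y Dy; rewrite lt_min => /andP[yd1].
have [->|yx] := eqVneq y x; first by rewrite !subrr normr0 => _; exact: ltW.
rewrite ltr_pdivlMr// => ye; have {}H := H y Dy yx yd1.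
apply: le_trans (ltW ye).
have yx0 : y - x != 0 by rewrite subr_eq0.
have -> : f x - f y = (y - x) * (- dq f x y) by rewrite /dq; field.
rewrite normrM normrN ler_wpM2l//.
rewrite -[dq f x y](subKr v) (le_trans (ler_normB _ _))// lerD2l.
exact: H.
Qed.

(** At interior doses the relative derivative is the ordinary one; at the two ends the fundamental
    theorem only asks for one-sided continuity of [f]. The case x = dL is an integral over a
    point. *)
Lemma C1_Dp_FTC f x : C1_Dp M f -> inDp M x ->
  \int[lebesgue_measure]_(l in `[dL M, x]) deriv_Dp M f l = f x - f (dL M).
Proof.
move=> /C1_Dp_deriv[fc fd] /[dup] Dx /andP[Lx xU].
move: Lx; rewrite le_eqVlt => /predU1P[<-|Lx].
  by rewrite set_itv1 Rintegral_set1 subrr.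
have diff y : dL M < y < x ->
    h^-1 *: (f (h + y) - f y) @[h --> 0^'] --> deriv_Dp M f y.
  move=> /andP[Ly yx]; have Dy : inDp M y.
    by rewrite /inDp (ltW Ly) (le_trans (ltW yx)).
  apply/cvgrPdist_le => e e0.
  have [del del0 H] := (dq_cvgP f y _).1 (fd y Dy) e e0.
  (* The radius is cut by both distances to the ends so that h + y remains a dose. *)
  pose r := Num.min del (Num.min (y - dL M) (x - y)).
  have r0 : 0 < r by rewrite !lt_min del0 !subr_gt0 Ly yx.
  rewrite near_withinE; apply/nbhs_ballP; exists r => // h.
  rewrite /ball /= sub0r normrN /r !lt_min => /and3P[hd h1 h2] h0.
  have Dhy : inDp M (h + y).
    move: h1 h2; rewrite /inDp !ltr_norml => /andP[? ?] /andP[? ?].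
    by apply/andP; split; lra.
  have := H (h + y) Dhy; rewrite /dq addrK mulrC; apply => //.
  by rewrite -subr_eq0 addrK.
rewrite /Rintegral (@continuous_FTC2 _ _ f)//.
- apply: continuous_subspaceW fc; apply: subset_itvl; rewrite bnd_simp //.
- split.
  + move=> y; rewrite in_itv /= => /diff fy; apply/cvg_ex; exists (deriv_Dp M f y).
    rewrite (_ : (fun h => _) = fun h => h^-1 *: (f (h + y) - f y))//.
    by apply/funext => h; rewrite /= [h *: 1]mulr1.
  + apply/cvgrPdist_le => e e0.
    have DL : inDp M (dL M) by rewrite /inDp lexx ltW.
    have [del del0 H] := dq_cvg_continuous (fd _ DL) e0.
    near=> z; have Lz : dL M < z by near: z; exact: nbhs_right_gt.
    have zU : z < dU M by near: z; exact: nbhs_right_lt.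
    have zd : z < dL M + del by near: z; apply: nbhs_right_lt; rewrite ltrDl.
    by apply: H; [rewrite /inDp !ltW|rewrite gtr0_norm; lra].
  + apply/cvgrPdist_le => e e0.
    have [del del0 H] := dq_cvg_continuous (fd _ Dx) e0.
    near=> z; have zx : z < x by near: z; exact: nbhs_left_lt.
    have Lz : dL M < z by near: z; exact: nbhs_left_gt.
    have zd : x - del < z by near: z; apply: nbhs_left_gt; rewrite gtrBl.
    apply: H; last by rewrite ltr0_norm; lra.
    by rewrite /inDp (ltW Lz) (le_trans (ltW zx)).
- move=> y; rewrite in_itv /= => /diff fy; rewrite /derive1.
  exact: cvg_lim fy.
Unshelve. all: by end_near. Qed.

End one_sided_derivative.


(** * Expectations within one treatment group *)

Section expectation_on_event.
Context {dsp : measure_display} {T : measurableType dsp} {R : realType}.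
Variable P : probability T R.
Implicit Types (X Y h : T -> R) (A S : set T).

Lemma integrable_onD S X Y : measurable S ->
  P.-integrable S (EFin \o X) -> P.-integrable S (EFin \o Y) ->
  P.-integrable S (EFin \o (fun w => X w + Y w)).
Proof. by move=> mS iX iY; have := integrableD mS iX iY. Qed.

Lemma integrable_onZ S (c : R) X : measurable S ->
  P.-integrable S (EFin \o X) -> P.-integrable S (EFin \o (fun w => c * X w)).
Proof. by move=> mS iX; have := integrableZl mS c iX. Qed.

Lemma integrable_onB S X Y : measurable S ->
  P.-integrable S (EFin \o X) -> P.-integrable S (EFin \o Y) ->
  P.-integrable S (EFin \o (fun w => X w - Y w)).
Proof. by move=> mS iX iY; have := integrableB mS iX iY. Qed.

Lemma integrable_on_cst S (c : R) : measurable S ->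
  P.-integrable S (EFin \o cst c).
Proof. by move=> mS; exact: finite_measure_integrable_cst. Qed.

Lemma integrable_on_bounded S X (C : R) : measurable S -> measurable_fun S X ->
  (forall w, S w -> `|X w| <= C) -> P.-integrable S (EFin \o X).
Proof.
move=> mS mX XC; apply: measurable_bounded_integrable => //.
  by rewrite ltey_eq fin_num_measure.
exists C; split; first exact: num_real.
by move=> K CK w /= Sw; rewrite (le_trans (XC w Sw))// ltW.
Qed.

Lemma eq_integrable_on S X Y : measurable S -> (forall w, S w -> X w = Y w) ->
  P.-integrable S (EFin \o X) -> P.-integrable S (EFin \o Y).
Proof.
move=> mS XY; apply: eq_integrable => //.
by move=> w /set_mem Sw /=; rewrite XY.
Qed.

Lemma eq_Eon A X Y : (forall w, A w -> X w = Y w) -> Eon P X A = Eon P Y A.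
Proof.
by move=> XY; congr fine; apply: eq_integral => w /set_mem Aw; rewrite XY.
Qed.

Lemma EonD A X Y : measurable A ->
  P.-integrable A (EFin \o X) -> P.-integrable A (EFin \o Y) ->
  Eon P (fun w => X w + Y w) A = Eon P X A + Eon P Y A.
Proof. by move=> mA iX iY; exact: (RintegralD mA iX iY). Qed.

Lemma EonB A X Y : measurable A ->
  P.-integrable A (EFin \o X) -> P.-integrable A (EFin \o Y) ->
  Eon P (fun w => X w - Y w) A = Eon P X A - Eon P Y A.
Proof. by move=> mA iX iY; exact: (RintegralB mA iX iY). Qed.

Lemma EonZ A (c : R) X : measurable A -> P.-integrable A (EFin \o X) ->
  Eon P (fun w => c * X w) A = c * Eon P X A.
Proof. by move=> mA iX; exact: RintegralZl. Qed.

Lemma Eon_cst A (c : R) : measurable A -> Eon P (cst c) A = c * Pr P A.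
Proof. by move=> mA; exact: Rintegral_cst. Qed.

Lemma Eon_ge0 A X : measurable A -> (forall w, A w -> 0 <= X w) ->
  0 <= Eon P X A.
Proof.
move=> mA X0; apply: fine_ge0; apply: integral_ge0 => w Aw; rewrite lee_fin.
exact: X0.
Qed.

Lemma eq_condE A X Y : (forall w, A w -> X w = Y w) -> condE P X A = condE P Y A.
Proof. by move=> XY; rewrite /condE (eq_Eon XY). Qed.

Lemma condED A X Y : measurable A ->
  P.-integrable A (EFin \o X) -> P.-integrable A (EFin \o Y) ->
  condE P (fun w => X w + Y w) A = condE P X A + condE P Y A.
Proof. by move=> mA iX iY; rewrite /condE EonD// mulrDl. Qed.

Lemma condEB A X Y : measurable A ->
  P.-integrable A (EFin \o X) -> P.-integrable A (EFin \o Y) ->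
  condE P (fun w => X w - Y w) A = condE P X A - condE P Y A.
Proof. by move=> mA iX iY; rewrite /condE EonB// mulrBl. Qed.

Lemma condEZ A (c : R) X : measurable A -> P.-integrable A (EFin \o X) ->
  condE P (fun w => c * X w) A = c * condE P X A.
Proof. by move=> mA iX; rewrite /condE EonZ// mulrA. Qed.

Lemma condE_cst A (c : R) : measurable A -> 0 < Pr P A -> condE P (cst c) A = c.
Proof. by move=> mA A0; rewrite /condE Eon_cst// mulfK// gt_eqF. Qed.

End expectation_on_event.

(** * Layer formulas, weights and covariance in one group *)

Section one_group.
Context {dsp : measure_display} {T : measurableType dsp} {R : realType}.
Variables (P : probability T R) (M : model T R) (g : nat).
Hypothesis HmD : measurable_fun setT (Dv M).
Hypothesis mS : measurable (evG M g).
Hypothesis Spos : inG P M g.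
Hypothesis SD : forall w, Gv M w = g -> dL M <= Dv M w <= dU M.
Hypothesis supp : forall x : R, dL M <= x <= dU M -> in_supp_GD P M g x.
Hypothesis dLU : dL M < dU M.
Implicit Types (X Y h : T -> R) (m : R -> R) (x v : R).

Local Notation S := (evG M g).
Local Notation D := (Dv M).

Lemma ev_GDnearE x e : ev_GDnear M g x e = S `&` D @^-1` cball x e.
Proof. by []. Qed.

Lemma measurable_ev_GDnear x e : measurable (ev_GDnear M g x e).
Proof.
rewrite ev_GDnearE; apply: measurableI => //.
by apply: measurable_preimageT => //; exact: measurable_cball.
Qed.

Lemma measurable_evDge l : measurable (evDge M l).
Proof.
rewrite (_ : evDge M l = D @^-1` `[l, +oo[); first exact: measurable_preimageT.
by apply/seteqP; split => w /=; rewrite in_itv /= andbT.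
Qed.

Lemma integrable_sub X A : measurable A -> A `<=` S ->
  P.-integrable S (EFin \o X) -> P.-integrable A (EFin \o X).
Proof. by move=> mA AS iX; exact: integrableS iX. Qed.

Lemma has_condE_GD_lin (c c' : R) X Y x v v' :
  P.-integrable S (EFin \o X) -> P.-integrable S (EFin \o Y) ->
  has_condE_GD P M X g x v -> has_condE_GD P M Y g x v' ->
  has_condE_GD P M (fun w => c * X w + c' * Y w) g x (c * v + c' * v').
Proof.
move=> iX iY Xv Yv; rewrite /has_condE_GD.
under eq_fun => e.
  have mA := measurable_ev_GDnear x e.
  have AS : ev_GDnear M g x e `<=` S by move=> w [].
  have iXA := integrable_sub mA AS iX.
  have iYA := integrable_sub mA AS iY.
  rewrite condED//; [|exact: integrable_onZ|exact: integrable_onZ].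
  rewrite condEZ// condEZ//.
  over.
by apply: cvgD; apply: cvgMr.
Qed.

Lemma eq_has_condE_GD X Y x v : (forall w, Gv M w = g -> X w = Y w) ->
  has_condE_GD P M X g x v -> has_condE_GD P M Y g x v.
Proof.
move=> XY; rewrite /has_condE_GD => H.
by under eq_fun do rewrite -(eq_condE P (fun w (Aw : ev_GDnear M g x _ w) => XY w Aw.1)).
Qed.

(** The ratio equals [c] only on balls of positive probability, which is what membership in the
    support provides. *)
Lemma has_condE_GD_cst (c x : R) : dL M <= x <= dU M ->
  has_condE_GD P M (cst c) g x c.
Proof.
move=> Dx; apply: cvg_near_cst.
near=> e; rewrite condE_cst//; first exact: measurable_ev_GDnear.
by apply: supp => //; near: e; exact: nbhs_right_gt.
Unshelve. all: by end_near. Qed.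

Lemma condE_GDE X x v : has_condE_GD P M X g x v -> condE_GD P M X g x = v.
Proof. by move=> Xv; apply: cvg_lim. Qed.

Lemma integrable_patch X : P.-integrable S (EFin \o X) ->
  P.-integrable setT ((EFin \o X) \_ S).
Proof. by move=> iX; apply: (integrable_mkcond _ mS).1. Qed.

Lemma Eon_has_condE X m A : P.-integrable S (EFin \o X) ->
  {within `[dL M, dU M], continuous m} ->
  (forall x, dL M <= x <= dU M -> has_condE_GD P M X g x (m x)) ->
  measurable A ->
  Eon P X (S `&` D @^-1` A) = Eon P (m \o D) (S `&` D @^-1` A).
Proof.
move=> iX mc Xm mA; rewrite ![S `&` _]setIC; congr fine.
apply: (@integral_of_symmetric_limit _ _ _ P S mS D X HmD (integrable_patch iX)
   (dL M) (dU M) m) => //.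
- by move=> x Dx e e0; rewrite setIC; exact: supp.
- by move=> x Dx; under eq_fun do rewrite setIC; exact: Xm.
Qed.

Lemma E_G_has_condE X m : P.-integrable S (EFin \o X) ->
  {within `[dL M, dU M], continuous m} ->
  (forall x, dL M <= x <= dU M -> has_condE_GD P M X g x (m x)) ->
  E_G P M X g = E_G P M (m \o D) g.
Proof.
move=> iX mc Xm; have := Eon_has_condE iX mc Xm measurableT.
by rewrite preimage_setT setIT /E_G /condE => ->.
Qed.

Lemma C1_Dp_within_continuous m : C1_Dp M m -> {within `[dL M, dU M], continuous m}.
Proof.
move=> /(C1_Dp_deriv dLU)[_ md]; apply/subspace_continuousP => x; rewrite /= in_itv /= => Dx.
apply/cvgrPdist_le => e e0.
have [del del0 H] := dq_cvg_continuous (md x Dx) e0.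
rewrite near_withinE; apply/nbhs_ballP; exists del => // y xy; rewrite /= in_itv /= => Dy.
by apply: H => //; rewrite distrC.
Qed.

Lemma C1_Dp_id : C1_Dp M (fun x : R => x) /\
  forall x, inDp M x -> deriv_Dp M (fun x : R => x) x = 1.
Proof.
have H x : dq (fun x : R => x) x @ within (inDp M) x^' --> (1 : R).
  apply/dq_cvgP => e e0; exists 1 => // y _ yx _.
  by rewrite /dq divff ?subr_eq0// subrr normr0 ltW.
split; last by move=> x Dx; apply: deriv_DpE.
by exists (cst 1); split => // x; exact: cvg_cst.
Qed.

Lemma integrable_mul_comp h m : P.-integrable S (EFin \o h) ->
  {within `[dL M, dU M], continuous m} ->
  P.-integrable S (EFin \o (fun w => h w * m (D w))).
Proof.
move=> ih mc; have [C C0 HC] := within_continuous_bounded mc.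
apply: (@eq_integrable_on _ _ _ P S (fun w => h w * (m \_ `[dL M, dU M]) (D w))) => //.
  by move=> w Sw; rewrite patchE mem_set//= in_itv /= SD.
have mmD : measurable_fun S ((m \_ `[dL M, dU M]) \o D).
  apply: measurable_funTS; apply: measurableT_comp => //.
  exact: within_continuous_measurable_patch.
have bmD : [bounded ((m \_ `[dL M, dU M]) \o D) x | x in S].
  exists C; split; first exact: num_real.
  move=> K CK w /= Sw; rewrite patchE mem_set//= ?in_itv /= ?SD//.
  by apply: (le_trans _ (ltW CK)); apply: HC; rewrite in_itv /= SD.
by have := integrableMl mS ih mmD bmD.
Qed.

(** The layer cake applied to m(D) - m(dL), written as the integral of m' from dL to D. The choice
    of [h] determines the weight on m'(l): a constant gives the survival function of [w1] and
    [w1_across], a multiple of D - E[D] gives [w1_within]. *)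
Lemma layer_formula h m : P.-integrable S (EFin \o h) -> C1_Dp M m ->
  (\int[lebesgue_measure]_(l in `[dL M, dU M])
      (deriv_Dp M m l * Eon P h (S `&` evDge M l))%:E =
   (Eon P (fun w => h w * (m (D w) - m (dL M))) S)%:E)%E /\
  lebesgue_measure.-integrable `[dL M, dU M]
    (fun l => (deriv_Dp M m l * Eon P h (S `&` evDge M l))%:E).
Proof.
move=> ih mC1; have [dc _] := C1_Dp_deriv dLU mC1.
split; last exact: (integrable_layer mS HmD (integrable_patch ih) dc).
have := layer_cake mS HmD (integrable_patch ih) SD dc.
rewrite /Eon => <-; rewrite fineK.
  apply: eq_integral => w /set_mem Sw; rewrite (C1_Dp_FTC dLU mC1)//.
  exact: SD.
apply: integrable_fin_num => //.
apply: (integrable_mul_comp (m := fun x => m x - m (dL M)) ih).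
apply: (C1_Dp_within_continuous (C1_Dp_lin dLU mC1 mC1 (c := 1) (c' := 0)
  (c0 := - m (dL M)) _).1) => x _; ring.
Qed.

Lemma PrS_gt0 : 0 < Pr P S. Proof. exact: Spos. Qed.
Let S0 := PrS_gt0.
Let S_neq0 : Pr P S != 0. Proof. by rewrite gt_eqF. Qed.

Lemma integrable_D : P.-integrable S (EFin \o D).
Proof.
apply: (@integrable_on_bounded _ _ _ P S D (`|dL M| + `|dU M|)) => //.
  exact: measurable_funTS.
move=> w /SD /andP[h1 h2].
have := ler_norm (dU M); have := ler_norm (- dL M); rewrite normrN => ? ?.
have := normr_ge0 (dU M); have := normr_ge0 (dL M) => ? ?.
by rewrite ler_norml; apply/andP; split; lra.
Qed.

Lemma integrable_mulD h (c : R) : P.-integrable S (EFin \o h) ->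
  P.-integrable S (EFin \o (fun w => h w * (D w - c))).
Proof.
move=> ih; apply: (integrable_mul_comp (m := fun x => x - c) ih).
have [idC1 _] := C1_Dp_id.
apply: (C1_Dp_within_continuous (C1_Dp_lin dLU idC1 idC1 (c := 1) (c' := 0)
  (c0 := - c) _).1) => x _; ring.
Qed.

Lemma integrable_comp m : {within `[dL M, dU M], continuous m} ->
  P.-integrable S (EFin \o (m \o D)).
Proof.
move=> mc; have := integrable_mul_comp (integrable_on_cst P 1 mS) mc.
by apply: eq_integrable_on => // w _ /=; rewrite mul1r.
Qed.

Lemma measurable_SDge l : measurable (S `&` evDge M l).
Proof. by apply: measurableI => //; exact: measurable_evDge. Qed.

Lemma E_G_centered : E_G P M (fun w => D w - meanD P M g) g = 0.
Proof.
rewrite /E_G condEB//; [|exact: integrable_D|exact: integrable_on_cst].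
by rewrite (_ : (fun _ => _) = cst (meanD P M g))// condE_cst// subrr.
Qed.

Lemma condP_Eon l (c : R) :
  Eon P (cst (c / Pr P S)) (S `&` evDge M l) = c * condP P (evDge M l) S.
Proof.
by rewrite Eon_cst; [rewrite /condP setIC; ring|exact: measurable_SDge].
Qed.

(** The factor [c] is left free: it is 1 / E[D] for [w1] and the inverse difference of two mean
    doses for the across-group weights. *)
Lemma mean_layer_formula m (c : R) : C1_Dp M m ->
  (\int[lebesgue_measure]_(l in `[dL M, dU M])
      (deriv_Dp M m l * (c * condP P (evDge M l) S))%:E =
   (c * (E_G P M (m \o D) g - m (dL M)))%:E)%E /\
  lebesgue_measure.-integrable `[dL M, dU M]
    (fun l => (deriv_Dp M m l * (c * condP P (evDge M l) S))%:E).
Proof.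
move=> mC1; have ic := integrable_on_cst P (c / Pr P S) mS.
have -> : (fun l => (deriv_Dp M m l * (c * condP P (evDge M l) S))%:E) =
    (fun l => (deriv_Dp M m l * Eon P (cst (c / Pr P S)) (S `&` evDge M l))%:E).
  by apply/funext => l; rewrite condP_Eon.
have [-> iw] := layer_formula ic mC1; split => //; congr EFin.
have mc := C1_Dp_within_continuous mC1.
rewrite EonZ//; last first.
  by apply: integrable_onB => //; [exact: integrable_comp|exact: integrable_on_cst].
rewrite EonB//; [|exact: integrable_comp|exact: integrable_on_cst].
rewrite [X in _ - X](_ : _ = m (dL M) * Pr P S); last exact: Eon_cst.
by rewrite /E_G /condE; field.
Qed.

Lemma Eon_null X A : measurable A -> A `<=` S -> P.-integrable S (EFin \o X) ->
  Pr P A = 0 -> Eon P X A = 0.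
Proof.
move=> mA AS iX A0; rewrite /Eon null_set_integral//.
  by have /measurable_int := integrable_sub mA AS iX.
have E : (Pr P A)%:E = P A by rewrite /Pr fineK// fin_num_measure.
by transitivity ((Pr P A)%:E) => //; rewrite A0.
Qed.

Lemma w1_within_Eon l :
  w1_within P M g l =
  Eon P (fun w => (D w - meanD P M g) / (Pr P S * varD P M g)) (S `&` evDge M l).
Proof.
have mA := measurable_SDge l; have AS : S `&` evDge M l `<=` S by exact: subIsetl.
have iDA := integrable_sub mA AS integrable_D.
under [in RHS]eq_fun do rewrite mulrC.
rewrite EonZ//; last by apply: integrable_onB => //; exact: integrable_on_cst.
rewrite EonB//; last exact: integrable_on_cst.
rewrite [X in _ - X](_ : _ = meanD P M g * Pr P (S `&` evDge M l)); last exact: Eon_cst.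
rewrite [(Pr P S * _)^-1]invfM /w1_within; set v := (varD P M g)^-1.
rewrite /condP /condE [evDge M l `&` S]setIC.
(* If no mass lies above [l], the conditional mean in the weight is 0 / 0, read as 0, but it is
   multiplied by probability 0 and both sides vanish. *)
have [p0|p0] := eqVneq (Pr P (S `&` evDge M l)) 0.
  rewrite p0 (Eon_null mA AS integrable_D p0); ring.
by field; rewrite ?p0 ?S_neq0.
Qed.

Lemma covD_layer X m : P.-integrable S (EFin \o X) -> C1_Dp M m ->
  (forall x, dL M <= x <= dU M -> has_condE_GD P M X g x (m x)) ->
  covD P M X g =
    E_G P M (fun w => (D w - meanD P M g) * (m (D w) - m (dL M))) g.
Proof.
(* The residual Z = X - m(D) is uncorrelated with D: E[Z; D >= l] = 0 for every
   l, and Z (D - dL) integrates to the integral of this over l. *)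
move=> iX mC1 Xm; have mc := C1_Dp_within_continuous mC1.
pose Z w := X w - m (D w).
have imD := integrable_comp mc.
have iZ : P.-integrable S (EFin \o Z) by exact: integrable_onB.
have Z0 l : Eon P Z (S `&` evDge M l) = 0.
  have mA := measurable_SDge l; have AS : S `&` evDge M l `<=` S by exact: subIsetl.
  rewrite EonB//; [|exact: integrable_sub iX|exact: integrable_sub imD].
  have := Eon_has_condE iX mc Xm (measurable_itv `[l, +oo[).
  rewrite (_ : D @^-1` _ = evDge M l) => [->|]; first by rewrite subrr.
  by apply/seteqP; split => w /=; rewrite in_itv /= andbT.
have ZD : Eon P (fun w => Z w * (D w - dL M)) S = 0.
  have [+ _] := layer_formula iZ C1_Dp_id.1.
  under eq_integral do rewrite Z0 mulr0.
  by rewrite integral0 => -[].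
have ZS : Eon P Z S = 0.
  have := Z0 (dL M); rewrite setIidl// => w Sw.
  by have /andP[] := SD Sw.
set EX := E_G P M X g; set ED := meanD P M g.
rewrite /covD -/EX -/ED.
have iDc : P.-integrable S (EFin \o (fun w => D w - ED)).
  by apply: integrable_onB => //; [exact: integrable_D|exact: integrable_on_cst].
have imDc : P.-integrable S (EFin \o (fun w => m (D w) - m (dL M))).
  by apply: integrable_onB => //; exact: integrable_on_cst.
have i4 : P.-integrable S (EFin \o (fun w => (D w - ED) * (m (D w) - m (dL M)))).
  have := integrable_mulD ED imDc.
  by apply: eq_integrable_on => // w _; rewrite mulrC.
(* X is written as Z + m(D), and the product is split around dL. The first, second and fourth terms
   have mean 0, by the two facts on Z and by centring of D; the third is the claim. *)
have -> : (fun w => (X w - EX) * (D w - ED)) =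
  (fun w => (Z w * (D w - dL M) + (dL M - ED) * Z w) +
    ((D w - ED) * (m (D w) - m (dL M)) + (m (dL M) - EX) * (D w - ED))).
  by apply/funext => w; rewrite /Z; ring.
have i1 := integrable_mulD (dL M) iZ.
have i2 := integrable_onZ (dL M - ED) mS iZ.
have i3 := integrable_onZ (m (dL M) - EX) mS iDc.
rewrite /E_G condED//; [|exact: integrable_onD|exact: integrable_onD].
rewrite condED// condED// condEZ// condEZ//.
rewrite [condE P (fun w => Z w * _) _]/condE ZD [condE P Z S]/condE ZS.
have := E_G_centered; rewrite -/ED /E_G => ->; ring.
Qed.

Lemma within_layer_formula m : C1_Dp M m ->
  (\int[lebesgue_measure]_(l in `[dL M, dU M])
      (deriv_Dp M m l * w1_within P M g l)%:E =
   (E_G P M (fun w => (D w - meanD P M g) * (m (D w) - m (dL M))) g /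
      varD P M g)%:E)%E.
Proof.
move=> mC1; have mc := C1_Dp_within_continuous mC1.
set ED := meanD P M g.
have iDc : P.-integrable S (EFin \o (fun w => D w - ED)).
  by apply: integrable_onB => //; [exact: integrable_D|exact: integrable_on_cst].
have ih : P.-integrable S (EFin \o (fun w => (D w - ED) / (Pr P S * varD P M g))).
  have := integrable_onZ (Pr P S * varD P M g)^-1 mS iDc.
  by apply: eq_integrable_on => // w _; rewrite mulrC.
have imDc : P.-integrable S (EFin \o (fun w => m (D w) - m (dL M))).
  apply: integrable_onB => //; [exact: integrable_comp|exact: integrable_on_cst].
have i4 : P.-integrable S (EFin \o (fun w => (D w - ED) * (m (D w) - m (dL M)))).
  have := integrable_mulD ED imDc.
  by apply: eq_integrable_on => // w _; rewrite mulrC.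
have [+ _] := layer_formula ih mC1.
under eq_integral do rewrite -w1_within_Eon.
move=> ->; congr EFin.
transitivity (Eon P (fun w => (Pr P S * varD P M g)^-1 *
    ((D w - ED) * (m (D w) - m (dL M)))) S).
  by apply: eq_Eon => w _; ring.
by rewrite EonZ// /E_G /condE invfM; ring.
Qed.

Lemma meanD_ge : dL M <= meanD P M g.
Proof.
rewrite /meanD /E_G /condE ler_pdivlMr// -subr_ge0.
rewrite -(Eon_cst P (dL M) mS) -EonB//; [|exact: integrable_D|exact: integrable_on_cst].
by apply: Eon_ge0 => // w /SD/andP[Lw _]; rewrite subr_ge0.
Qed.

(** The distinct doses dL and dU both lie in the support, so some support point x differs from the
    mean. The ball around x of half their distance has positive probability, and D stays at distance
    at least e from the mean on it. *)
Lemma varD_gt0 : 0 < varD P M g.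
Proof.
set ED := meanD P M g.
have [x Dx xED] : exists2 x, dL M <= x <= dU M & x != ED.
  have [E|] := eqVneq (dL M) ED; last by exists (dL M) => //; rewrite lexx ltW.
  by exists (dU M); rewrite -?E ?lexx ?ltW// gt_eqF.
pose e := `|x - ED| / 2.
have xE0 : 0 < `|x - ED| by rewrite normr_gt0 subr_eq0.
have e0 : 0 < e by rewrite divr_gt0.
have PA := supp Dx e0; have mA := measurable_ev_GDnear x e.
have AS : ev_GDnear M g x e `<=` S by move=> w [].
have iDc : P.-integrable S (EFin \o (fun w => D w - ED)).
  by apply: integrable_onB => //; [exact: integrable_D|exact: integrable_on_cst].
have i2 : P.-integrable S (EFin \o (fun w => (D w - ED) ^+ 2)).
  by have := integrable_mulD ED iDc; apply: eq_integrable_on.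
rewrite /varD /E_G /condE divr_gt0//.
apply: (@lt_le_trans _ _ (e ^+ 2 * Pr P (ev_GDnear M g x e))).
  by rewrite mulr_gt0// exprn_gt0.
rewrite -(Eon_cst P (e ^+ 2) mA).
apply: (@le_trans _ _ (Eon P (fun w => (D w - ED) ^+ 2) (ev_GDnear M g x e))).
  rewrite -subr_ge0 -EonB//; [|exact: integrable_sub i2|exact: integrable_on_cst].
  apply: Eon_ge0 => // w [_ wx]; rewrite subr_ge0 -[leRHS]real_normK ?num_real//.
  rewrite ler_pXn2r ?nnegrE ?(ltW e0)//.
  by have := ler_distD (D w) x ED; rewrite (distrC x (D w)); move: wx; rewrite /e; lra.
rewrite /Eon fine_le//.
- by apply: integrable_fin_num => //; exact: integrable_sub i2.
- exact: integrable_fin_num.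
apply: ge0_subset_integral => //; first by have /measurable_int := i2.
by move=> w _; rewrite lee_fin sqr_ge0.
Qed.

(** Above the mean the integrand is nonnegative. Below it, D - E[D] has total mean 0, so its
    integral over D >= l is minus its integral over D < l, where it is negative. *)
Lemma w1_within_ge0 l : 0 <= w1_within P M g l.
Proof.
rewrite w1_within_Eon; set ED := meanD P M g.
have c0 : 0 < Pr P S * varD P M g by rewrite mulr_gt0// varD_gt0.
have mA := measurable_SDge l; have AS : S `&` evDge M l `<=` S by exact: subIsetl.
have [lE|lE] := leP ED l.
  apply: Eon_ge0 => // w [_ lw]; rewrite divr_ge0 ?(ltW c0)// subr_ge0.
  exact: le_trans lw.
have iDc : P.-integrable S (EFin \o (fun w => D w - ED)).
  by apply: integrable_onB => //; [exact: integrable_D|exact: integrable_on_cst].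
have mB : measurable (S `\` evDge M l) by apply: measurableD => //; exact: measurable_evDge.
have BS : S `\` evDge M l `<=` S by exact: subDsetl.
under eq_fun do rewrite mulrC.
rewrite EonZ ?mulr_ge0 ?invr_ge0 ?(ltW c0)//; last exact: integrable_sub iDc.
have : Eon P (fun w => D w - ED) S = 0.
  by have /eqP := E_G_centered; rewrite /E_G /condE mulf_eq0 invr_eq0 (negbTE S_neq0) orbF => /eqP.
have -> : Eon P (fun w => D w - ED) S =
    Eon P (fun w => D w - ED) (S `&` evDge M l) +
    Eon P (fun w => D w - ED) (S `\` evDge M l).
  have U : S = (S `&` evDge M l) `|` (S `\` evDge M l) by rewrite setUIDK.
  rewrite {1}U /Eon integral_setU//.
  - rewrite fineD//; apply: integrable_fin_num => //; exact: integrable_sub iDc.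
  - by rewrite -U; have /measurable_int := iDc.
  - by apply/disj_setPS => w [[_ ?] [_]].
move=> E; have : 0 <= Eon P (fun w => - 1 * (D w - ED)) (S `\` evDge M l).
  apply: Eon_ge0 => // w [_ /negP]; rewrite -ltNge mulN1r opprB subr_ge0 => wl.
  by rewrite (le_trans (ltW wl))// ltW.
rewrite EonZ//; last exact: integrable_sub iDc.
lra.
Qed.

Lemma w1_ge0 l : 0 < dL M -> 0 <= w1 P M g l.
Proof.
move=> L0; apply: divr_ge0; last exact: le_trans (ltW L0) meanD_ge.
by apply: divr_ge0; exact: fine_ge0.
Qed.

Lemma w0_ge0 : 0 < dL M -> 0 <= w0 P M g.
Proof. by move=> L0; rewrite /w0 divr_ge0 ?ltW// (lt_le_trans L0 meanD_ge). Qed.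

(** The mean layer formula for m(x) = x, whose derivative is 1. *)
Lemma int_condP : 
  (\int[lebesgue_measure]_(l in `[dL M, dU M]) (condP P (evDge M l) S)%:E =
   (meanD P M g - dL M)%:E)%E /\
  lebesgue_measure.-integrable `[dL M, dU M]
    (fun l => (condP P (evDge M l) S)%:E).
Proof.
have [idC1 idd] := C1_Dp_id.
have [+ i1] := mean_layer_formula 1 idC1; rewrite mul1r => E1.
split.
  rewrite -[RHS]E1; apply: eq_integral => l; rewrite inE /= in_itv /= => Dl.
  by rewrite idd// !mul1r.
apply: eq_integrable i1 => // l; rewrite inE /= in_itv /= => Dl.
by rewrite idd// !mul1r.
Qed.

(** Again m(x) = x: E[(D - E[D]) (D - dL)] is the variance, because replacing dL by E[D] changes it
    by a multiple of a centred mean. *)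
Lemma int_w1_within :
  (\int[lebesgue_measure]_(l in `[dL M, dU M]) (w1_within P M g l)%:E = 1)%E.
Proof.
have [idC1 idd] := C1_Dp_id; have := within_layer_formula idC1 => E1.
transitivity (\int[lebesgue_measure]_(l in `[dL M, dU M])
    (deriv_Dp M (fun x : R => x) l * w1_within P M g l)%:E)%E.
  apply: eq_integral => l; rewrite inE /= in_itv /= => Dl.
  by rewrite idd// !mul1r.
rewrite E1; congr EFin.
suff -> : E_G P M (fun w => (D w - meanD P M g) * (D w - dL M)) g = varD P M g.
  by rewrite divff// gt_eqF// varD_gt0.
have iDc : P.-integrable S (EFin \o (fun w => D w - meanD P M g)).
  by apply: integrable_onB => //; [exact: integrable_D|exact: integrable_on_cst].
have -> : (fun w => (D w - meanD P M g) * (D w - dL M)) =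
  (fun w => (D w - meanD P M g) ^+ 2 + (meanD P M g - dL M) * (D w - meanD P M g)).
  by apply/funext => w; ring.
rewrite /E_G condED//; last 2 first.
- by have := integrable_mulD (meanD P M g) iDc; apply: eq_integrable_on.
- exact: integrable_onZ.
rewrite condEZ//; have := E_G_centered; rewrite /E_G => ->.
by rewrite mulr0 addr0.
Qed.

End one_group.


(** * Parallel trends and the decompositions *)

Lemma square_integrable_integrable {d} {T : measurableType d} {R : realType}
    (P : probability T R) (S : set T) (X : T -> R) : measurable S ->
  measurable_fun S X -> P.-integrable S (EFin \o (fun w => X w ^+ 2)) ->
  P.-integrable S (EFin \o X).
Proof.
move=> mS mX iX2.
(* The squares (X - 1)^2 and (X + 1)^2 are nonnegative, so 2 |X| <= 1 + X^2. *)
have i1 := integrable_onD mS (integrable_on_cst P 1 mS) iX2.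
apply: le_integrable i1 => //; first exact/measurable_EFinP.
move=> w _ /=; rewrite lee_fin [leRHS]ger0_norm ?addr_ge0 ?sqr_ge0//.
rewrite ler_norml; have := sqr_ge0 (X w - 1); have := sqr_ge0 (X w + 1).
by rewrite !expr2 => ? ?; apply/andP; split; nra.
Qed.

Definition wavg {R : realType} (A : nat * nat) (f : nat -> R) : R :=
  (\sum_(A.1 <= t < A.2.+1) f t) / wlen A.

Lemma wavgD {R : realType} A (f f' : nat -> R) :
  wavg A (fun t => f t + f' t) = wavg A f + wavg A f'.
Proof. by rewrite /wavg big_split mulrDl. Qed.

Lemma integrable_on_sum {d} {T : measurableType d} {R : realType}
    (P : probability T R) (S : set T) (X : nat -> T -> R) (s : seq nat) :
  measurable S -> (forall t, t \in s -> P.-integrable S (EFin \o X t)) ->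
  P.-integrable S (EFin \o (fun w => \sum_(t <- s) X t w)).
Proof.
move=> mS; elim: s => [_|t s IH tX].
  by under [X in EFin \o X]eq_fun do rewrite big_nil; exact: integrable_on_cst.
under [X in EFin \o X]eq_fun do rewrite big_cons.
apply: integrable_onD => //; first by apply: tX; rewrite mem_head.
by apply: IH => u us; apply: tX; rewrite in_cons us orbT.
Qed.

Lemma condE_sum {d} {T : measurableType d} {R : realType}
    (P : probability T R) (S : set T) (X : nat -> T -> R) (s : seq nat) :
  measurable S -> (forall t, t \in s -> P.-integrable S (EFin \o X t)) ->
  condE P (fun w => \sum_(t <- s) X t w) S = \sum_(t <- s) condE P (X t) S.
Proof.
move=> mS; elim: s => [_|t s IH tX].
  under eq_fun do rewrite big_nil.
  by rewrite big_nil /condE (Eon_cst P 0 mS) mul0r mul0r.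
have sX u : u \in s -> P.-integrable S (EFin \o X u).
  by move=> us; apply: tX; rewrite in_cons us orbT.
under eq_fun do rewrite big_cons.
rewrite condED//; [|by apply: tX; rewrite mem_head|exact: integrable_on_sum].
by rewrite big_cons IH.
Qed.

Section model_facts.
Context {dsp : measure_display} {T : measurableType dsp} {R : realType}.
Variables (P : probability T R) (M : model T R).
Hypothesis HmD : measurable_fun setT (Dv M).
Hypothesis HmG : forall g : nat, measurable (evG M g).
Hypothesis HmYp : forall (t g : nat) (x : R), measurable_fun setT (Yp M t g x).
Hypothesis HmYpD : forall t g : nat, measurable_fun setT (fun w => Yp M t g (Dv M w) w).
Hypothesis HL2obs : forall t : nat, (1 <= t <= nT M)%N ->
  P.-integrable setT (fun w => (Yobs M t w ^+ 2)%:E).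
Hypothesis HL2po : forall (t g : nat) (x : R), (1 <= t <= nT M)%N -> inG P M g ->
  inDose M x -> P.-integrable setT (fun w => (Yp M t g x w ^+ 2)%:E).
Hypothesis HGrange : forall w, (2 <= Gv M w <= (nT M).+1)%N.
Hypothesis HD0 : forall w, Dv M w = 0 <-> Gv M w = (nT M).+1.
Hypothesis HDpos : forall w, (Gv M w <= nT M)%N -> dL M <= Dv M w <= dU M.
Hypothesis H2a_P0 : 0 < Pr P (evD0 M).
Hypothesis H2a_suppG : forall (g : nat) (x : R), inG P M g -> (g <= nT M)%N ->
  dL M <= x <= dU M -> in_supp_GD P M g x.
Hypothesis H2b : 0 < dL M /\ dL M < dU M.
Hypothesis H2c : forall g t : nat, inG P M g -> (g <= nT M)%N -> (2 <= t <= nT M)%N ->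
  (forall x, dL M <= x <= dU M -> exists v, has_condE_GD P M (dYobs M t) g x v) /\
  C1_Dp M (condE_GD P M (dYobs M t) g).
Hypothesis H3a : forall (g t : nat) (x : R) w, inG P M g -> inDose M x -> (1 <= t)%N ->
  (t < g)%N -> Yp M t g x w = Y0 M t w.
Hypothesis H5a : forall (g t : nat) (x : R), inG P M g -> (2 <= t <= nT M)%N ->
  inDose M x -> in_supp_GD P M g x ->
  has_condE_GD P M (fun w => Yp M t g (Dv M w) w - Y0 M t.-1 w) g x
    (E_G P M (fun w => Yp M t g x w - Y0 M t.-1 w) g).
Hypothesis H5b : forall (g t : nat) (x : R), inG P M g -> (2 <= t <= nT M)%N ->
  inDose M x -> in_supp_GD P M g x ->
  has_condE_GD P M (fun w => Y0 M t w - Y0 M t.-1 w) g x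
    (E_D0 P M (fun w => Y0 M t w - Y0 M t.-1 w)).

Local Notation D := (Dv M).

(** The order of the end points makes the truncated subtraction in [wlen] count the periods; the
    outer bounds keep all periods where moments are assumed. *)
Definition window A := (1 <= A.1 <= A.2)%N && (A.2 <= nT M)%N.

Lemma window_mem A t : window A -> t \in index_iota A.1 A.2.+1 -> (1 <= t <= nT M)%N.
Proof.
move=> /andP[/andP[A1 _] A2]; rewrite mem_index_iota => /andP[h1 h2].
by rewrite (leq_trans A1 h1) (leq_trans _ A2).
Qed.

Lemma wavg_cst A (c : R) : window A -> wavg A (fun=> c) = c.
Proof.
move=> /andP[/andP[_ A12] _].
by rewrite /wavg /wlen sumr_const_nat subSn// addn1 -[c *+ _]mulr_natr mulfK.
Qed.

Lemma integrable_wavg (S : set T) A (X : nat -> T -> R) : measurable S -> window A ->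
  (forall t, (1 <= t <= nT M)%N -> P.-integrable S (EFin \o X t)) ->
  P.-integrable S (EFin \o (fun w => wavg A (X ^~ w))).
Proof.
move=> mS wA iX.
have := integrable_onZ (wlen A)^-1 mS
  (integrable_on_sum mS (fun u us => iX u (window_mem wA us))).
by apply: eq_integrable_on => // w _; rewrite mulrC.
Qed.

Lemma condE_wavg (S : set T) A (X : nat -> T -> R) : measurable S -> window A ->
  (forall t, (1 <= t <= nT M)%N -> P.-integrable S (EFin \o X t)) ->
  condE P (fun w => wavg A (X ^~ w)) S = wavg A (fun t => condE P (X t) S).
Proof.
move=> mS wA iX.
have iA := integrable_on_sum mS (fun u us => iX u (window_mem wA us)).
rewrite /wavg -condE_sum; [|by []|by move=> u us; exact: iX (window_mem wA us)].
by under eq_condE do rewrite mulrC; rewrite condEZ// mulrC.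
Qed.

(** Lets facts about timing groups be applied to the event D = 0. *)
Lemma evD0E : evD0 M = evG M (nT M).+1.
Proof. by apply/seteqP; split => w /= /HD0. Qed.

Lemma inG_never : inG P M (nT M).+1.
Proof. by rewrite /inG -evD0E. Qed.

Lemma measurable_evD0 : measurable (evD0 M).
Proof. by rewrite evD0E. Qed.

Lemma inG_ge2 g : inG P M g -> (2 <= g)%N.
Proof.
rewrite /inG leqNgt => Sg; apply/negP => g2.
suff E : evG M g = set0 by move: Sg; rewrite E /Pr measure0 /= ltxx.
apply/seteqP; split => // w /= Gw.
by have := HGrange w; rewrite Gw leqNgt g2.
Qed.

Lemma integrable_Y0 t S : (1 <= t <= nT M)%N -> measurable S ->
  P.-integrable S (EFin \o Y0 M t).
Proof.
move=> tT mS.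
have iT : P.-integrable setT (EFin \o Y0 M t).
  apply: square_integrable_integrable => //; first exact: HmYp.
  by apply: HL2po => //; [exact: inG_never|left].
exact: integrableS iT.
Qed.

Lemma integrable_Yp t g x S : (1 <= t <= nT M)%N -> inG P M g -> inDose M x ->
  measurable S -> P.-integrable S (EFin \o Yp M t g x).
Proof.
move=> tT Ig Dx mS.
have iT : P.-integrable setT (EFin \o Yp M t g x).
  by apply: square_integrable_integrable => //; exact: HL2po.
exact: integrableS iT.
Qed.

Lemma integrable_Yobs t g : (1 <= t <= nT M)%N ->
  P.-integrable (evG M g) (EFin \o Yobs M t).
Proof.
move=> tT; apply: square_integrable_integrable => //; last first.
  exact: (integrableS measurableT (HmG g) (@subsetT _ _) (HL2obs tT)).
(* On G = g the group index inside [Yobs] is frozen, which leaves a single potential outcome. *)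
apply: (@eq_measurable_fun _ _ _ _ _
  (fun w => if (t < g)%N then Y0 M t w else Yp M t g (Dv M w) w)).
  by move=> w /set_mem Gw; rewrite /Yobs (_ : Gv M w = g).
have [tg|gt] := ltnP t g; apply: measurable_funTS; [exact: HmYp|exact: HmYpD].
Qed.

(** The effect at the unit's own timing and dose. Observed outcomes become an untreated path,
    governed by its trend, plus [tau]. *)
Definition tau t w : R := Yobs M t w - Y0 M t w.

Lemma integrable_tau t g : (1 <= t <= nT M)%N ->
  P.-integrable (evG M g) (EFin \o tau t).
Proof.
by move=> tT; apply: integrable_onB => //; [exact: integrable_Yobs|exact: integrable_Y0].
Qed.

Lemma tau_before t w : (t < Gv M w)%N -> tau t w = 0.
Proof. by move=> tG; rewrite /tau /Yobs tG subrr. Qed.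

(** * Conditional mean changes in a treated group *)

Section treated_group.
Variable g : nat.
Hypotheses (Ig : inG P M g) (gT : (g <= nT M)%N).

Let mS : measurable (evG M g) := HmG g.
Let SD w : Gv M w = g -> dL M <= Dv M w <= dU M.
Proof. by move=> Gw; apply: HDpos; rewrite Gw. Qed.
Let supp x : dL M <= x <= dU M -> in_supp_GD P M g x := H2a_suppG Ig gT.
Let L0 := H2b.1.
Let dLU := H2b.2.

Lemma trend t x : (2 <= t <= nT M)%N -> dL M <= x <= dU M ->
  has_condE_GD P M (fun w => Y0 M t w - Y0 M t.-1 w) g x
    (E_D0 P M (fun w => Y0 M t w - Y0 M t.-1 w)).
Proof. by move=> tT Dx; apply: H5b => //; [right|exact: supp]. Qed.

Lemma pred_window t : (2 <= t <= nT M)%N -> (1 <= t.-1 <= nT M)%N /\ (1 <= t <= nT M)%N.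
Proof.
move=> /andP[h1 h2]; rewrite h2 (ltnW h1) -ltnS prednK ?(ltnW h1)// h1.
by rewrite (leq_trans (leq_pred _) h2).
Qed.

(** The conditional mean trend is the same constant at every dose, so averaging over D returns
    it. *)
Lemma trend_mean t : (2 <= t <= nT M)%N ->
  E_G P M (fun w => Y0 M t w - Y0 M t.-1 w) g =
  E_D0 P M (fun w => Y0 M t w - Y0 M t.-1 w).
Proof.
move=> tT; have [t1 t2] := pred_window tT.
set c := E_D0 P M (fun w => Y0 M t w - Y0 M t.-1 w).
rewrite (@E_G_has_condE _ _ _ P M g HmD mS SD supp _ (cst c)).
- exact: condE_cst.
- by apply: integrable_onB => //; exact: integrable_Y0.
- by move=> x; exact: cvg_cst.
- by move=> x Dx; exact: trend.
Qed.

Lemma ATE_before t x : (1 <= t)%N -> (t < g)%N -> dL M <= x <= dU M ->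
  ATE P M g t x = 0.
Proof.
move=> t1 tg Dx; rewrite /ATE /E_G -[RHS](condE_cst 0 mS Ig).
by apply: eq_condE => w _; rewrite H3a ?subrr//; right.
Qed.

(** Both halves of strong parallel trends measure from Y_{t-1}(0), which cancels on subtracting
    them. [trend_mean] turns the untreated trend into a mean over G = g, so that the remaining
    difference is the ATE at dose x. Before treatment both sides are 0. *)
Lemma tau_has_condE t x : (1 <= t <= nT M)%N -> dL M <= x <= dU M ->
  has_condE_GD P M (tau t) g x (ATE P M g t x).
Proof.
move=> tT Dx; have [tg|gt] := ltnP t g.
  rewrite ATE_before//; last by case/andP: tT.
  apply: (eq_has_condE_GD _ (has_condE_GD_cst HmD mS supp Dx)) => w Gw.
  by rewrite tau_before ?Gw.
have t2 : (2 <= t <= nT M)%N.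
  by rewrite (leq_trans (inG_ge2 Ig) gt); case/andP: tT.
have [tT1 _] := pred_window t2.
have Dose : inDose M x by right.
have iY0t := integrable_Y0 tT mS; have iY0p := integrable_Y0 tT1 mS.
have iYp := integrable_Yp tT Ig Dose mS.
have YE w : Gv M w = g -> Yobs M t w = Yp M t g (Dv M w) w.
  by move=> Gw; rewrite /Yobs Gw ltnNge gt.
have iX : P.-integrable (evG M g)
    (EFin \o (fun w => Yp M t g (Dv M w) w - Y0 M t.-1 w)).
  apply: (eq_integrable_on mS _ (integrable_onB mS (integrable_Yobs g tT) iY0p)).
  by move=> w Gw; rewrite YE.
have iY := integrable_onB mS iY0t iY0p.
have := has_condE_GD_lin HmD mS (c := 1) (c' := (-1)) iX iY (H5a Ig t2 Dose (supp Dx)) (trend t2 Dx).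
rewrite (_ : _ + _ = ATE P M g t x).
  by apply: eq_has_condE_GD => w Gw; rewrite /tau YE//; ring.
rewrite -trend_mean// /ATE /E_G mulN1r mul1r -condEB//; last exact: integrable_onB.
by apply: eq_condE => w _; ring.
Qed.

(** One-period trends telescoped back to period 1, a common base from which any two windows can be
    compared. *)
Lemma base_has_condE t x : (1 <= t <= nT M)%N -> dL M <= x <= dU M ->
  has_condE_GD P M (fun w => Y0 M t w - Y0 M 1 w) g x
    (E_D0 P M (fun w => Y0 M t w - Y0 M 1 w)).
Proof.
move=> tT Dx; elim: t tT => [//|[|t] IH] tT.
  rewrite /E_D0 (_ : (fun _ => _) = cst 0); last first.
    by apply/funext => w; rewrite subrr.
  by rewrite condE_cst//; [exact: has_condE_GD_cst|exact: measurable_evD0].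
have tT' : (1 <= t.+1 <= nT M)%N by case/andP: tT => _ /ltnW.
have T1 : (1 <= 1 <= nT M)%N by case/andP: tT' => h1 h2; rewrite /= (leq_trans h1 h2).
have i (S : set T) (mS' : measurable S) :=
  integrable_onB mS' (integrable_Y0 tT' mS') (integrable_Y0 T1 mS').
have i' (S : set T) (mS' : measurable S) :=
  integrable_onB mS' (integrable_Y0 tT mS') (integrable_Y0 tT' mS').
have := has_condE_GD_lin HmD mS (c := 1) (c' := 1) (i' _ mS) (i _ mS) (trend (tT : (2 <= t.+2 <= nT M)%N) Dx) (IH tT').
rewrite !mul1r /E_D0 -condED; [|exact: measurable_evD0|exact/i'/measurable_evD0|
  exact/i/measurable_evD0].
rewrite (_ : (fun w => _ + _) = (fun w => Y0 M t.+2 w - Y0 M 1 w)); last first.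
  by apply/funext => w /=; ring.
rewrite (_ : (fun w => 1 * _ + _) = (fun w => Y0 M t.+2 w - Y0 M 1 w))//.
by apply/funext => w /=; ring.
Qed.

(** Smoothness of the ATE is inherited recursively: ATE_t(x) is ATE_{t-1}(x) plus the conditional
    mean of the observed change at x, minus the untreated trend, which is constant in x. *)
Lemma ATE_C1 t : (1 <= t <= nT M)%N -> C1_Dp M (ATE P M g t).
Proof.
have [idC1 _] := C1_Dp_id dLU.
elim: t => [//|[|t] IH] tT.
  (* Period 1 precedes every group since g >= 2, so the ATE is 0 there; the identity with zero
     coefficients serves as a smooth representative. *)
  apply: (C1_Dp_lin dLU idC1 idC1 (c := 0) (c' := 0) (c0 := 0) _).1 => x Dx.
  rewrite ATE_before//; [by ring|exact: inG_ge2].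
have tT' : (1 <= t.+1 <= nT M)%N by case/andP: tT => _ /ltnW.
have [_ dC1] := H2c Ig gT (tT : (2 <= t.+2 <= nT M)%N).
apply: (C1_Dp_lin dLU dC1 (IH tT') (c := 1) (c' := 1)
  (c0 := - E_D0 P M (fun w => Y0 M t.+2 w - Y0 M t.+1 w)) _).1 => x Dx.
have iY := integrable_onB mS (integrable_Y0 tT mS) (integrable_Y0 tT' mS).
have i1 := integrable_tau g tT; have i0 := integrable_tau g tT'.
have := has_condE_GD_lin HmD mS (c := 1) (c' := (-1)) i1 i0 (tau_has_condE tT Dx) (tau_has_condE tT' Dx).
move=> /(has_condE_GD_lin HmD mS (c := 1) (c' := 1) iY
  (integrable_onD mS (integrable_onZ 1 mS i1) (integrable_onZ (-1) mS i0))
  (trend (tT : (2 <= t.+2 <= nT M)%N) Dx)).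
move=> /(@eq_has_condE_GD _ _ _ P M g _ (dYobs M t.+2)) H.
rewrite (condE_GDE (H _)); first by ring.
by move=> w _; rewrite /tau /dYobs /=; ring.
Qed.

Lemma ATEbar_before A x : window A -> (A.2 < g)%N -> dL M <= x <= dU M ->
  ATEbar P M A g x = 0.
Proof.
move=> wA Ag Dx; rewrite /ATEbar big_seq big1 ?mul0r// => t tA.
have /andP[t1 _] := window_mem wA tA.
apply: ATE_before => //; move: tA; rewrite mem_index_iota ltnS => /andP[_ tA].
exact: leq_ltn_trans Ag.
Qed.

Lemma has_condE_GD_wavg A (X : nat -> T -> R) (v : nat -> R) x : window A ->
  dL M <= x <= dU M ->
  (forall t, (1 <= t <= nT M)%N -> P.-integrable (evG M g) (EFin \o X t)) ->
  (forall t, (1 <= t <= nT M)%N -> has_condE_GD P M (X t) g x (v t)) ->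
  has_condE_GD P M (fun w => wavg A (X ^~ w)) g x (wavg A v).
Proof.
move=> wA Dx iX Xv.
have H : has_condE_GD P M
    (fun w => \sum_(t <- index_iota A.1 A.2.+1) X t w) g x
    (\sum_(t <- index_iota A.1 A.2.+1) v t).
  have := @window_mem A; elim: (index_iota _ _) => [|t s IH] tA.
    by under eq_fun do rewrite big_nil; rewrite big_nil; exact: has_condE_GD_cst.
  rewrite big_cons; under eq_fun do rewrite big_cons.
  have tT : (1 <= t <= nT M)%N by apply: tA => //; rewrite mem_head.
  have sT u : u \in s -> (1 <= u <= nT M)%N.
    by move=> us; apply: tA => //; rewrite in_cons us orbT.
  have := has_condE_GD_lin HmD mS (c := 1) (c' := 1) (iX t tT)
    (integrable_on_sum mS (fun u us => iX u (sT u us))) (Xv t tT) (IH (fun u _ => sT u)).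
  rewrite !mul1r; apply: eq_has_condE_GD => w _; by rewrite !mul1r.
have iH := integrable_on_sum mS (fun u us => iX u (@window_mem A u wA us)).
have := has_condE_GD_lin HmD mS (c := (wlen A)^-1) (c' := 0) iH iH H H.
rewrite !mul0r addr0 mulrC; apply: eq_has_condE_GD => w _.
by rewrite mul0r addr0 mulrC.
Qed.

(** A window average is Y_1(0) plus the averages of Y_t(0) - Y_1(0) and of [tau]. In a difference of
    windows Y_1(0) cancels, the second part follows the never treated, and the third contributes the
    ATE averages. *)
Lemma dYbar_has_condE A A' x : window A -> window A' -> dL M <= x <= dU M ->
  has_condE_GD P M (dYbar M A A') g x
    (ATEbar P M A g x - ATEbar P M A' g x + E_D0 P M (dYbar M A A')).
Proof.
move=> wA wA' Dx.
pose b t w : R := Y0 M t w - Y0 M 1 w.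
have T1 : (1 <= 1 <= nT M)%N by case/andP: wA => /andP[h1 h2] h3; rewrite /= (leq_trans h1 (leq_trans h2 h3)).
have ib (S : set T) (mS' : measurable S) t : (1 <= t <= nT M)%N -> P.-integrable S (EFin \o b t).
  by move=> tT; apply: integrable_onB => //; exact: integrable_Y0.
have ibt t : (1 <= t <= nT M)%N -> P.-integrable (evG M g) (EFin \o (fun w => b t w + tau t w)).
  by move=> tT; apply: integrable_onD => //; [exact: ib|exact: integrable_tau].
have lim t : (1 <= t <= nT M)%N ->
    has_condE_GD P M (fun w => b t w + tau t w) g x (E_D0 P M (b t) + ATE P M g t x).
  move=> tT.
  have := has_condE_GD_lin HmD mS (c := 1) (c' := 1) (ib _ mS t tT) (integrable_tau g tT)
    (base_has_condE tT Dx) (tau_has_condE tT Dx).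
  by rewrite !mul1r; apply: eq_has_condE_GD => w _; rewrite !mul1r.
have decomp B w : window B -> Ybar M B w = Y0 M 1 w + wavg B (fun t => b t w + tau t w).
  move=> wB; rewrite -{1}[Y0 M 1 w](wavg_cst (A := B))// -wavgD /Ybar /wavg.
  by congr (_ / _); apply: eq_bigr => t _; rewrite /b /tau; ring.
(* For D = 0 the timing group lies beyond the last period of any window, so every [tau] is 0 and the
   pure trend remains. *)
have H0 : E_D0 P M (dYbar M A A') =
    wavg A (fun t => E_D0 P M (b t)) - wavg A' (fun t => E_D0 P M (b t)).
  rewrite /E_D0 -!condE_wavg//; [|exact: measurable_evD0|by move=> t; exact: (ib _ measurable_evD0)|
    exact: measurable_evD0|by move=> t; exact: (ib _ measurable_evD0)].
  rewrite -condEB; [|exact: measurable_evD0|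
    by apply: integrable_wavg => // [|t]; [exact: measurable_evD0|exact: (ib _ measurable_evD0)]..].
  apply: eq_condE => w /HD0 Gw.
  have tau0 B : window B -> wavg B (fun t => b t w + tau t w) = wavg B (b ^~ w).
    move=> wB; rewrite /wavg; congr (_ / _); apply: eq_big_seq => t tB.
    have /andP[_ tT] := window_mem wB tB.
    by rewrite tau_before ?addr0// Gw ltnS.
  by rewrite /dYbar !decomp// !tau0//; ring.
have i1 := integrable_wavg mS wA ibt.
have i2 := integrable_wavg mS wA' ibt.
have := has_condE_GD_lin HmD mS (c := 1) (c' := -1) i1 i2
  (has_condE_GD_wavg wA Dx ibt lim) (has_condE_GD_wavg wA' Dx ibt lim).
rewrite (_ : 1 * _ + _ = ATEbar P M A g x - ATEbar P M A' g x + E_D0 P M (dYbar M A A')).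
  by apply: eq_has_condE_GD => w _; rewrite /dYbar !decomp//; ring.
rewrite H0 !wavgD mul1r mulN1r /ATEbar -/(wavg _ _) -/(wavg _ _); ring.
Qed.

Lemma ATEbar_C1 A : window A -> C1_Dp M (ATEbar P M A g).
Proof.
move=> wA; have [idC1 _] := C1_Dp_id dLU.
have H : C1_Dp M (fun x => \sum_(t <- index_iota A.1 A.2.+1) ATE P M g t x).
  have := @window_mem A; elim: (index_iota _ _) => [|t s IH] tA.
    apply: (C1_Dp_lin dLU idC1 idC1 (c := 0) (c' := 0) (c0 := 0) _).1 => x Dx.
    by rewrite big_nil; ring.
  have sT u : u \in s -> (1 <= u <= nT M)%N.
    by move=> us; apply: tA => //; rewrite in_cons us orbT.
  have tT : (1 <= t <= nT M)%N by apply: tA => //; rewrite mem_head.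
  apply: (C1_Dp_lin dLU (ATE_C1 tT) (IH (fun u _ => sT u)) (c := 1) (c' := 1) (c0 := 0) _).1 => x Dx.
  by rewrite big_cons; ring.
apply: (C1_Dp_lin dLU H H (c := (wlen A)^-1) (c' := 0) (c0 := 0) _).1 => x Dx.
by rewrite /ATEbar; ring.
Qed.

Lemma integrable_dYbar A A' : window A -> window A' ->
  P.-integrable (evG M g) (EFin \o dYbar M A A').
Proof.
move=> wA wA'; apply: integrable_onB => //; apply: integrable_wavg => // t tT;
  exact: integrable_Yobs.
Qed.

(** The conditional mean of [dYbar] at dose x when [A'] ends before treatment. It differs from
    [ATEbar] by a constant, hence has derivative [ACRbar]. *)
Definition cmean A A' x : R := ATEbar P M A g x + E_D0 P M (dYbar M A A').

Lemma cmean_has_condE A A' x : window A -> window A' -> (A'.2 < g)%N ->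
  dL M <= x <= dU M -> has_condE_GD P M (dYbar M A A') g x (cmean A A' x).
Proof.
move=> wA wA' Ag Dx; have := dYbar_has_condE wA wA' Dx.
by rewrite (ATEbar_before wA')// subr0.
Qed.

Lemma cmean_C1 A A' : window A ->
  C1_Dp M (cmean A A') /\
  forall x, dL M <= x <= dU M -> deriv_Dp M (cmean A A') x = ACRbar P M A g x.
Proof.
move=> wA; have aC1 := ATEbar_C1 wA.
have [|h1 h2] := C1_Dp_lin dLU aC1 aC1 (c := 1) (c' := 0)
  (c0 := E_D0 P M (dYbar M A A')) (h := cmean A A') _.
  by move=> x _; rewrite /cmean; ring.
by split => // x Dx; rewrite h2// mul1r mul0r addr0.
Qed.

Lemma E_G_cmean A A' : window A -> window A' -> (A'.2 < g)%N ->
  E_G P M (dYbar M A A') g = E_G P M (cmean A A' \o D) g.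
Proof.
move=> wA wA' Ag; have [mC1 _] := cmean_C1 A' wA.
apply: (E_G_has_condE HmD mS SD supp).
- exact: integrable_dYbar.
- exact: C1_Dp_within_continuous.
- by move=> x Dx; exact: cmean_has_condE.
Qed.

(** What makes a later group a valid comparison while it is not yet treated. *)
Lemma E_G_before A A' : window A -> window A' -> (A.2 < g)%N -> (A'.2 < g)%N ->
  E_G P M (dYbar M A A') g = E_D0 P M (dYbar M A A').
Proof.
move=> wA wA' Ag Ag'; rewrite E_G_cmean//.
rewrite -[RHS](condE_cst _ mS Ig); apply: eq_condE => w Gw.
by rewrite /= /cmean ATEbar_before// ?add0r//; exact: SD.
Qed.

(** Subtracting the change among the never treated removes the trend from [cmean] and leaves the
    treatment effect. *)
Lemma piD_cmean A A' : window A -> window A' -> (A'.2 < g)%N ->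
  [/\ forall x, dL M <= x <= dU M -> piD P M A A' g x = ATEbar P M A g x &
   forall x, dL M <= x <= dU M -> deriv_Dp M (piD P M A A' g) x = ACRbar P M A g x].
Proof.
move=> wA wA' Ag.
have E x : dL M <= x <= dU M -> piD P M A A' g x = ATEbar P M A g x.
  by move=> Dx; rewrite /piD (condE_GDE (cmean_has_condE wA wA' Ag Dx)) /cmean addrK.
split => // x Dx; have aC1 := ATEbar_C1 wA.
have [|_ ->//] := C1_Dp_lin dLU aC1 aC1 (c := 1) (c' := 0) (c0 := 0)
  (h := piD P M A A' g) _; last by rewrite mul1r mul0r addr0.
by move=> y Dy; rewrite E//; ring.
Qed.

End treated_group.
Lemma eq_integral_Dp (f f' : R -> R) :
  (forall x, dL M <= x <= dU M -> f x = f' x) ->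
  (\int[lebesgue_measure]_(l in `[dL M, dU M]) (f l)%:E =
   \int[lebesgue_measure]_(l in `[dL M, dU M]) (f' l)%:E)%E.
Proof.
move=> ff'; apply: eq_integral => l; rewrite inE /= in_itv /= => Dl.
by rewrite ff'.
Qed.

Lemma treated_dose g w : (g <= nT M)%N -> Gv M w = g -> dL M <= Dv M w <= dU M.
Proof. by move=> gT Gw; apply: HDpos; rewrite Gw. Qed.

Lemma window_POST g : inG P M g -> (g <= nT M)%N -> window (POST M g).
Proof. by move=> Ig gT; rewrite /window /= gT leqnn (ltnW (inG_ge2 Ig)). Qed.

(** Nonempty because g >= 2: period 1 always precedes treatment. *)
Lemma window_PRE g : inG P M g -> (g <= nT M)%N -> window (PRE g).
Proof.
move=> /inG_ge2 g2 gT; rewrite /window /= -ltnS prednK ?(ltnW g2)// g2.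
exact: leq_trans (leq_pred _) gT.
Qed.

Lemma window_MID g k : inG P M g -> (g < k)%N -> (k <= nT M)%N -> window (MID g k).
Proof.
move=> /inG_ge2 g2 gk kT; rewrite /window /= (ltnW g2) /= -ltnS prednK ?gk /=.
  exact: leq_trans (leq_pred _) kT.
exact: leq_ltn_trans gk.
Qed.

Lemma pred_lt g h : inG P M g -> (g <= h)%N -> (g.-1 < h)%N.
Proof. by move=> /inG_ge2 g2 gh; rewrite prednK// (ltnW g2). Qed.

Lemma meanD_gt0 g : inG P M g -> (g <= nT M)%N -> 0 < meanD P M g.
Proof.
move=> Ig gT; apply: lt_le_trans H2b.1 _.
by apply: meanD_ge => // w; exact: treated_dose.
Qed.

Lemma weights_properties g : inG P M g -> (g <= nT M)%N ->
  (forall l, dL M <= l <= dU M -> 0 <= w1_within P M g l /\ 0 <= w1 P M g l) /\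
  0 <= w0 P M g /\
  (\int[lebesgue_measure]_(l in `[dL M, dU M]) (w1_within P M g l)%:E = 1)%E /\
  (\int[lebesgue_measure]_(l in `[dL M, dU M]) (w1 P M g l)%:E + (w0 P M g)%:E = 1)%E.
Proof.
move=> Ig gT; have [L0 dLU] := H2b; have mS := HmG g.
have SD w : Gv M w = g -> dL M <= Dv M w <= dU M by exact: treated_dose.
have supp x : dL M <= x <= dU M -> in_supp_GD P M g x by exact: H2a_suppG.
split; first by move=> l _; split; [exact: w1_within_ge0|exact: w1_ge0].
split; first exact: w0_ge0.
split; first exact: int_w1_within.
have ED := meanD_gt0 Ig gT.
have [E iE] := int_condP HmD mS Ig SD dLU.
(* The weights [w1] integrate to (E[D] - dL) / E[D]; [w0] is the missing dL / E[D]. *)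
rewrite /w1; under eq_integral do rewrite mulrC EFinM.
rewrite integralZl// E -EFinM -EFinD /w0; congr EFin; field.
by rewrite gt_eqF.
Qed.

(** * Decompositions for an earlier and a later group *)

Section two_groups.
Variables g k : nat.
Hypotheses (Ig : inG P M g) (Ik : inG P M k) (gk : (g < k)%N) (kT : (k <= nT M)%N).

Let gT : (g <= nT M)%N. Proof. by rewrite (leq_trans (ltnW gk)). Qed.
Let L0 := H2b.1.
Let dLU := H2b.2.
Let mg := HmG g.
Let mk := HmG k.
Let SDg w : Gv M w = g -> dL M <= Dv M w <= dU M. Proof. exact: treated_dose. Qed.
Let SDk w : Gv M w = k -> dL M <= Dv M w <= dU M. Proof. exact: treated_dose. Qed.
Let suppg x : dL M <= x <= dU M -> in_supp_GD P M g x := H2a_suppG Ig gT.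
Let wPOSTg := window_POST Ig gT.
Let wPOSTk := window_POST Ik kT.
Let wPREg := window_PRE Ig gT.
Let wMID := window_MID Ig gk kT.
Let PREg : ((PRE g).2 < g)%N. Proof. exact: pred_lt. Qed.
Let PREk : ((PRE g).2 < k)%N. Proof. exact: (pred_lt Ig (ltnW gk)). Qed.
Let MIDk : ((MID g k).2 < k)%N. Proof. exact: (pred_lt Ik). Qed.
Let EDg : meanD P M g != 0. Proof. by rewrite gt_eqF// meanD_gt0. Qed.
Let EDk : meanD P M k != 0. Proof. by rewrite gt_eqF// meanD_gt0. Qed.

Lemma delta_withinE : ((delta_within P M g)%:E =
  \int[lebesgue_measure]_(l in `[dL M, dU M])
    (w1_within P M g l * ACRbar P M (POST M g) g l)%:E)%E.
Proof.
have [mC1 md] := cmean_C1 Ig gT (PRE g) wPOSTg.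
rewrite /delta_within (covD_layer HmD mg Ig SDg suppg dLU _ mC1); last 2 first.
- exact: integrable_dYbar.
- by move=> x Dx; exact: cmean_has_condE.
rewrite -(within_layer_formula HmD mg Ig SDg dLU mC1).
by apply: eq_integral_Dp => x Dx; rewrite md// mulrC.
Qed.

(** Group [k] is untreated in both windows and removes the trend. What remains is the mean effect in
    group [g]: its value at dL, which gives the [w0] term, plus the layered derivative. *)
Lemma delta_mid_preE : ((delta_mid_pre P M g k)%:E =
  \int[lebesgue_measure]_(l in `[dL M, dU M])
    (w1 P M g l * ACRbar P M (MID g k) g l)%:E
  + (w0 P M g * (ATEbar P M (MID g k) g (dL M) / dL M))%:E)%E.
Proof.
have [mC1 md] := cmean_C1 Ig gT (PRE g) wMID.
have [E _] := mean_layer_formula HmD mg Ig SDg dLU ((meanD P M g)^-1) mC1.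
rewrite (_ : integral _ _ _ = ((meanD P M g)^-1 *
  (E_G P M (cmean g (MID g k) (PRE g) \o D) g - cmean g (MID g k) (PRE g) (dL M)))%:E)%E;
  last first.
  by rewrite -E; apply: eq_integral_Dp => x Dx; rewrite md// /w1; ring.
rewrite /delta_mid_pre (E_G_cmean Ig gT)// (E_G_before Ik kT)//.
rewrite -EFinD /w0; congr EFin; rewrite /cmean.
have dLn : dL M != 0 by rewrite gt_eqF.
by field; rewrite EDg dLn.
Qed.

Lemma delta_post_midE : ((delta_post_mid P M g k)%:E =
  \int[lebesgue_measure]_(l in `[dL M, dU M])
    (w1 P M k l * ACRbar P M (POST M k) k l)%:E
  + (w0 P M k * (ATEbar P M (POST M k) k (dL M) / dL M))%:E
  - (w0 P M k * ((piG P M (POST M k) (PRE g) g - piG P M (MID g k) (PRE g) g)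
                 / dL M))%:E)%E.
Proof.
have [mC1 md] := cmean_C1 Ik kT (MID g k) wPOSTk.
have [E _] := mean_layer_formula HmD mk Ik SDk dLU ((meanD P M k)^-1) mC1.
rewrite (_ : integral _ _ _ = ((meanD P M k)^-1 *
  (E_G P M (cmean k (POST M k) (MID g k) \o D) k
     - cmean k (POST M k) (MID g k) (dL M)))%:E)%E; last first.
  by rewrite -E; apply: eq_integral_Dp => x Dx; rewrite md// /w1; ring.
rewrite /delta_post_mid (E_G_cmean Ik kT)//.
have split_dYbar h : condE P (dYbar M (POST M k) (MID g k)) (evG M h) =
    condE P (dYbar M (POST M k) (PRE g)) (evG M h) -
    condE P (dYbar M (MID g k) (PRE g)) (evG M h).
  rewrite -condEB//; [|exact: integrable_dYbar|exact: integrable_dYbar].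
  by apply: eq_condE => w _; rewrite /dYbar; ring.
have splitg : E_G P M (dYbar M (POST M k) (MID g k)) g =
    E_G P M (dYbar M (POST M k) (PRE g)) g - E_G P M (dYbar M (MID g k) (PRE g)) g.
  exact: split_dYbar.
have split0 : E_D0 P M (dYbar M (POST M k) (MID g k)) =
    E_D0 P M (dYbar M (POST M k) (PRE g)) - E_D0 P M (dYbar M (MID g k) (PRE g)).
  by rewrite /E_D0 evD0E; exact: split_dYbar.
have EFin_DB (x u v z : R) : x = u + v - z -> (x%:E = u%:E + v%:E - z%:E)%E by move=> ->.
apply: EFin_DB; rewrite splitg /w0 /cmean /piG split0.
have dLn : dL M != 0 by rewrite gt_eqF.
by field; rewrite EDk dLn.
Qed.

(** In the difference of the two integrated survival functions dL cancels, leaving the difference of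
    the mean doses. *)
Lemma int_w1_across : meanD P M g <> meanD P M k ->
  (\int[lebesgue_measure]_(l in `[dL M, dU M]) (w1_across P M g k l)%:E = 1)%E.
Proof.
move=> /eqP; rewrite -subr_eq0 => Egk.
have [Eg ig] := int_condP HmD mg Ig SDg dLU.
have [Ek ik] := int_condP HmD mk Ik SDk dLU.
rewrite /w1_across; under eq_integral do rewrite mulrC EFinM EFinB.
rewrite integralZl//; last exact: integrableB.
rewrite integralB// Eg Ek -EFinB -EFinM; congr EFin.
by field.
Qed.

(** Let m_g and m_k be the conditional mean curves. Then E_g[m_g] - E_k[m_k] = (E_g[m_g] - E_k[m_g])
    - E_k[m_k - m_g]. The first part compares two dose distributions along one curve, so the values
    at dL cancel; the second compares two curves under the doses of [k] and keeps them. *)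
Lemma delta_post_preE : meanD P M g <> meanD P M k ->
  ((delta_post_pre P M g k)%:E =
    \int[lebesgue_measure]_(l in `[dL M, dU M])
       (w1_across P M g k l * ACRbar P M (POST M k) g l)%:E
    - (\int[lebesgue_measure]_(l in `[dL M, dU M])
         (tw1_across P M g k l *
           (deriv_Dp M (piD P M (POST M k) (PRE g) k) l
            - deriv_Dp M (piD P M (POST M k) (PRE g) g) l))%:E
       + (tw0_across P M g k *
           ((piD P M (POST M k) (PRE g) k (dL M)
             - piD P M (POST M k) (PRE g) g (dL M)) / dL M))%:E))%E.
Proof.
move=> /eqP; rewrite -subr_eq0 => Egk.
have [mgC1 mgd] := cmean_C1 Ig gT (PRE g) wPOSTk.
have [mkC1 mkd] := cmean_C1 Ik kT (PRE g) wPOSTk.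
have [pg pgd] := piD_cmean Ig gT wPOSTk wPREg PREg.
have [pk pkd] := piD_cmean Ik kT wPOSTk wPREg PREk.
set c := (meanD P M g - meanD P M k)^-1.
have [Egg igg] := mean_layer_formula HmD mg Ig SDg dLU c mgC1.
(* The cross term: the curve of group [g] averaged over the doses of group [k]. *)
have [Ekg ikg] := mean_layer_formula HmD mk Ik SDk dLU c mgC1.
have [Ekk ikk] := mean_layer_formula HmD mk Ik SDk dLU c mkC1.
have -> : (\int[lebesgue_measure]_(l in `[dL M, dU M])
    (w1_across P M g k l * ACRbar P M (POST M k) g l)%:E =
  (c * (E_G P M (cmean g (POST M k) (PRE g) \o D) g - cmean g (POST M k) (PRE g) (dL M)))%:E
  - (c * (E_G P M (cmean g (POST M k) (PRE g) \o D) k - cmean g (POST M k) (PRE g) (dL M)))%:E)%E.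
  rewrite -Egg -Ekg -integralB//; apply: eq_integral => x.
  rewrite inE /= in_itv /= => Dx.
  by rewrite -EFinB mgd// /w1_across -/c; congr EFin; ring.
have -> : (\int[lebesgue_measure]_(l in `[dL M, dU M])
    (tw1_across P M g k l * (deriv_Dp M (piD P M (POST M k) (PRE g) k) l
            - deriv_Dp M (piD P M (POST M k) (PRE g) g) l))%:E =
  (c * (E_G P M (cmean k (POST M k) (PRE g) \o D) k - cmean k (POST M k) (PRE g) (dL M)))%:E
  - (c * (E_G P M (cmean g (POST M k) (PRE g) \o D) k - cmean g (POST M k) (PRE g) (dL M)))%:E)%E.
  rewrite -Ekk -Ekg -integralB//; apply: eq_integral => x.
  rewrite inE /= in_itv /= => Dx.
  by rewrite -EFinB mgd// mkd// pgd// pkd// /tw1_across -/c; congr EFin; ring.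
have DL : dL M <= dL M <= dU M by rewrite lexx ltW.
have EFin_BBD (x u v p q r : R) : x = u - v - (p - q + r) ->
  (x%:E = u%:E - v%:E - (p%:E - q%:E + r%:E))%E by move=> ->.
rewrite pg// pk//; apply: EFin_BBD.
rewrite /delta_post_pre (E_G_cmean Ig gT)// (E_G_cmean Ik kT)// /tw0_across -/c.
have dLn : dL M != 0 by rewrite gt_eqF.
by rewrite /cmean; field.
Qed.

End two_groups.
End model_facts.

Unset Implicit Arguments.

Theorem theorem5 (R : realType) (dsp : measure_display) (T : measurableType dsp)
  (P : probability T R) (M : model T R)
  (* regularity: measurability of all random variables involved *)
  (HmD : measurable_fun setT (Dv M))
  (HmG : forall g : nat, measurable (evG M g))
  (HmYp : forall (t g : nat) (x : R), measurable_fun setT (Yp M t g x))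
  (HmYpD : forall t g : nat, measurable_fun setT (fun w => Yp M t g (Dv M w) w))
  (* finite second moments *)
  (HL2obs : forall t : nat, (1 <= t <= nT M)%N ->
     P.-integrable setT (fun w => (Yobs M t w ^+ 2)%:E))
  (HL2po : forall (t g : nat) (x : R), (1 <= t <= nT M)%N -> inG P M g -> inDose M x ->
     P.-integrable setT (fun w => (Yp M t g x w ^+ 2)%:E))
  (* timing groups take values in {2, ..., T+1} *)
  (HGrange : forall w, (2 <= Gv M w <= (nT M).+1)%N)
  (* D = 0 exactly for the never treated, D in D_+ for the treated *)
  (HD0 : forall w, Dv M w = 0 <-> Gv M w = (nT M).+1)
  (HDpos : forall w, (Gv M w <= nT M)%N -> dL M <= Dv M w <= dU M)
  (* Assumption 2-MP (a) *)
  (H2a_supp : forall x : R, in_supp_D P M x <-> inDose M x)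
  (H2a_P0 : 0 < Pr P (evD0 M))
  (H2a_suppG : forall (g : nat) (x : R), inG P M g -> (g <= nT M)%N ->
     dL M <= x <= dU M -> in_supp_GD P M g x)
  (* Assumption 2-MP (b) *)
  (H2b : 0 < dL M /\ dL M < dU M)
  (* Assumption 2-MP (c) *)
  (H2c : forall g t : nat, inG P M g -> (g <= nT M)%N -> (2 <= t <= nT M)%N ->
     (forall x, dL M <= x <= dU M -> exists v, has_condE_GD P M (dYobs M t) g x v) /\
     C1_Dp M (condE_GD P M (dYobs M t) g))
  (* Assumption 3-MP (a): no anticipation *)
  (H3a : forall (g t : nat) (x : R) w, inG P M g -> inDose M x -> (1 <= t)%N -> (t < g)%N ->
     Yp M t g x w = Y0 M t w)
  (* Assumption 3-MP (b): staggered adoption *)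
  (H3b1 : forall w, W M 1 w = 0)
  (H3b2 : forall (t : nat) w, (2 <= t <= nT M)%N -> W M t.-1 w <> 0 -> W M t w = W M t.-1 w)
  (* Assumption 5-MP: strong parallel trends *)
  (H5a : forall (g t : nat) (x : R), inG P M g -> (2 <= t <= nT M)%N -> inDose M x ->
     in_supp_GD P M g x ->
     has_condE_GD P M (fun w => Yp M t g (Dv M w) w - Y0 M t.-1 w) g x
       (E_G P M (fun w => Yp M t g x w - Y0 M t.-1 w) g))
  (H5b : forall (g t : nat) (x : R), inG P M g -> (2 <= t <= nT M)%N -> inDose M x ->
     in_supp_GD P M g x ->
     has_condE_GD P M (fun w => Y0 M t w - Y0 M t.-1 w) g x
       (E_D0 P M (fun w => Y0 M t w - Y0 M t.-1 w))) :
  (* properties of the weights *)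
  (forall g : nat, inG P M g -> (g <= nT M)%N ->
     (forall l, dL M <= l <= dU M -> 0 <= w1_within P M g l /\ 0 <= w1 P M g l) /\
     0 <= w0 P M g /\
     (\int[lebesgue_measure]_(l in `[dL M, dU M]) (w1_within P M g l)%:E = 1)%E /\
     (\int[lebesgue_measure]_(l in `[dL M, dU M]) (w1 P M g l)%:E + (w0 P M g)%:E = 1)%E)
  /\
  (* decompositions *)
  (forall g k : nat, inG P M g -> inG P M k -> (g < k)%N -> (k <= nT M)%N ->
     ((delta_within P M g)%:E =
        \int[lebesgue_measure]_(l in `[dL M, dU M])
           (w1_within P M g l * ACRbar P M (POST M g) g l)%:E)%E
  /\ ((delta_mid_pre P M g k)%:E =
        \int[lebesgue_measure]_(l in `[dL M, dU M])
           (w1 P M g l * ACRbar P M (MID g k) g l)%:E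
        + (w0 P M g * (ATEbar P M (MID g k) g (dL M) / dL M))%:E)%E
  /\ ((delta_post_mid P M g k)%:E =
        \int[lebesgue_measure]_(l in `[dL M, dU M])
           (w1 P M k l * ACRbar P M (POST M k) k l)%:E
        + (w0 P M k * (ATEbar P M (POST M k) k (dL M) / dL M))%:E
        - (w0 P M k * ((piG P M (POST M k) (PRE g) g - piG P M (MID g k) (PRE g) g)
                       / dL M))%:E)%E
  /\ (meanD P M g <> meanD P M k ->
        (\int[lebesgue_measure]_(l in `[dL M, dU M]) (w1_across P M g k l)%:E = 1)%E /\
        ((delta_post_pre P M g k)%:E =
          \int[lebesgue_measure]_(l in `[dL M, dU M])
             (w1_across P M g k l * ACRbar P M (POST M k) g l)%:E
          - (\int[lebesgue_measure]_(l in `[dL M, dU M])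
               (tw1_across P M g k l *
                 (deriv_Dp M (piD P M (POST M k) (PRE g) k) l
                  - deriv_Dp M (piD P M (POST M k) (PRE g) g) l))%:E
             + (tw0_across P M g k *
                 ((piD P M (POST M k) (PRE g) k (dL M)
                   - piD P M (POST M k) (PRE g) g (dL M)) / dL M))%:E))%E)).
Proof.
split=> [g Ig gT|g k Ig Ik gk kT].
  by eapply weights_properties; eassumption.
split; first by eapply delta_withinE; eassumption.
split; first by eapply delta_mid_preE; eassumption.
split; first by eapply delta_post_midE; eassumption.
move=> Egk; split; first by eapply int_w1_across; eassumption.
by eapply delta_post_preE; eassumption.
Qed.
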